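(* Let $\mathbf A,\mathbf b,\mathbf c$ describe an explicit $3$-stage Runge--Kutta scheme and let $\mathbf f^{[\nu]}\in\mathcal C^4$ for $\nu=1,\dots,N$. Then the corresponding MPRK scheme (see context) is at least of order $p=s=3$ if and only if, as $\Delta t\to0$, $$\sigma_\mu=y^n_\mu+\Delta t\,f_\mu(\mathbf y^n)+\tfrac{\Delta t^2}{2}\bigl(\mathbf D\mathbf f(\mathbf y^n)\mathbf f(\mathbf y^n)\bigr)_\mu+\mathcal O(\Delta t^3),\qquad\mu=1,\dots,N,$$ $$\sum_{i=2}^3 b_ic_i\,\frac{y^n_\nu+\Delta t\,c_i f_\nu(\mathbf y^n)}{\pi_\nu^{(i)}}=\frac12+\mathcal O(\Delta t^2),\qquad \nu=1,\dots,N,$$ $$\pi_\nu^{(i)}=y_\nu^n+\mathcal O(\Delta t),\qquad \nu=1,\dots,N,\ i=2,3.$$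
   Context: Conservative autonomous production-destruction system (PDS): $y_k'=\sum_{\nu=1}^N\bigl(p_{k\nu}(\mathbf y)-d_{k\nu}(\mathbf y)\bigr)$, $k=1,\dots,N$, with positive initial data, where $p_{k\nu},d_{k\nu}\ge0$ for $\mathbf y\ge\mathbf 0$, $p_{k\nu}=d_{\nu k}$ and $p_{kk}=d_{kk}=0$. It is written as $\mathbf y'=\mathbf f(\mathbf y)=\sum_{\nu=1}^N\mathbf f^{[\nu]}(\mathbf y)$ with $f^{[\nu]}_k=p_{k\nu}$ for $k\ne\nu$ and $f^{[k]}_k=-\sum_{\mu=1}^N d_{k\mu}$. $\mathbf D\mathbf f$ is the Jacobian of $\mathbf f$. Standing assumptions: each $\mathbf f^{[\nu]}$ is Lipschitz continuous; the Runge--Kutta coefficients satisfy $\mathbf A,\mathbf b\ge\mathbf 0$ and $\sum_{j}a_{ij}=c_i$. MPRK (modified Patankar--Runge--Kutta) scheme: for $k=1,\dots,N$, $$y_k^{(i)}=y_k^n+\Delta t\sum_{j=1}^{i-1}a_{ij}\sum_{\nu=1}^N\Bigl(p_{k\nu}(\mathbf y^{(j)})\frac{y_\nu^{(i)}}{\pi_\nu^{(i)}}-d_{k\nu}(\mathbf y^{(j)})\frac{y_k^{(i)}}{\pi_k^{(i)}}\Bigr),\ i=1,\dots,s,$$ $$y_k^{n+1}=y_k^n+\Delta t\sum_{j=1}^{s}b_{j}\sum_{\nu=1}^N\Bigl(p_{k\nu}(\mathbf y^{(j)})\frac{y_\nu^{n+1}}{\sigma_\nu}-d_{k\nu}(\mathbf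 y^{(j)})\frac{y_k^{n+1}}{\sigma_k}\Bigr),$$ here with $s=3$. The Patankar-weight denominators $\pi_\nu^{(i)}=\pi_\nu^{(i)}(\mathbf y^n,\mathbf y^{(1)},\dots,\mathbf y^{(i-1)})$ and $\sigma_\nu=\sigma_\nu(\mathbf y^n,\mathbf y^{(1)},\dots,\mathbf y^{(s)})$ are positive for every $\Delta t\ge0$, continuous, and independent of $\mathbf y^{(i)}$ and $\mathbf y^{n+1}$, respectively. Here $\mathbf y^n>\mathbf 0$. The expression $\mathbf y^n+\Delta t\,\mathbf f(\mathbf y^n)+\tfrac{\Delta t^2}{2}\mathbf D\mathbf f(\mathbf y^n)\mathbf f(\mathbf y^n)$ is the truncated NB-series $\mathrm{NB}_2(\tfrac1\gamma,\mathbf y^n)$ of the exact solution. Order: the method is of order at least $p$ if, starting from exact data $\mathbf y^n=\mathbf y(t_n)$, one step satisfies $\mathbf y^{n+1}-\mathbf y(t_n+\Delta t)=\mathcal O(\Delta t^{p+1})$ as $\Delta t\to0$. As usual for order conditions, the equivalence is understood for arbitrary right-hand sides of the stated class (elementary differentials regarded as linearly independent).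
   Formalization: The underlying 3-stage Runge–Kutta scheme is assumed to be of order 3 and N ≥ 2, as the claim fails otherwise; order means that the Patankar weights, as functions of Δt, give error O(Δt^4) for every conservative PDS of the class. *)

(* Defs.v *)
From HB Require Import structures.
From mathcomp Require Import all_boot all_order all_algebra.
From mathcomp Require Import all_classical all_reals all_analysis.

Set Implicit Arguments.
Unset Strict Implicit.
Unset Printing Implicit Defensive.

Import Order.TTheory GRing.Theory Num.Theory.
Import numFieldNormedType.Exports.
Local Open Scope classical_set_scope.
Local Open Scope ring_scope.

(* Vectors of R^N are rows, and the stages y^(1), ..., y^(s) of a one-step
   method are the rows of an s x N matrix, so that the arguments of the
   Patankar-weight denominators carry the library's topology. Stage indices
   start at 0: the stage y^(i) of the text is [row (i-1) Y]. *)

Definition bigO_dt (R : realType) (q : nat) (e : R -> R) : Prop :=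
  e =O_ (0^'+) (fun dt : R => dt ^+ q).

(* f is C^q on the open set U; C^(q+1) means differentiable with all first
   partial derivatives C^q. *)
Fixpoint Ck (R : realType) (q m n : nat) (U : set 'rV[R]_m)
    (f : 'rV[R]_m -> 'rV[R]_n) : Prop :=
  match q with
  | 0%N => forall y, U y -> {for y, continuous f}
  | q'.+1 => (forall y, U y -> differentiable f y) /\
             forall i : 'I_m, Ck q' U (fun y => 'D_(delta_mx 0 i) f y)
  end.

Definition positive_mx (R : realType) (m n : nat) (M : 'M[R]_(m, n)) : Prop :=
  forall i j, 0 < M i j.

Definition nonneg_mx (R : realType) (m n : nat) (M : 'M[R]_(m, n)) : Prop :=
  forall i j, 0 <= M i j.

(* y solves y' = F(y), y(t0) = y0 on [t0, t0 + T[. *)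
Definition ivp_solution (R : realType) (m : nat) (F : 'rV[R]_m -> 'rV[R]_m)
    (t0 T : R) (y0 : 'rV[R]_m) (y : R -> 'rV[R]_m) : Prop :=
  [/\ y t0 = y0, y t @[t --> t0^'+] --> y0 &
      forall t, t0 < t < t0 + T -> is_derive t 1 y (F (y t))].

Section PDS.
Variables (R : realType) (N : nat).
Implicit Types p d : 'I_N -> 'I_N -> 'rV[R]_N -> R.

(* The field f^[nu] of the additive splitting. *)
Definition pds_part p d (nu : 'I_N) (y : 'rV[R]_N) : 'rV[R]_N :=
  \row_k (if k == nu then - \sum_mu d k mu y else p k nu y).

Definition pds_rhs p d (y : 'rV[R]_N) : 'rV[R]_N :=
  \sum_nu pds_part p d nu y.

(* Conservative PDS with Lipschitz parts of class C^q. The rates are total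
   functions, but only their values on the nonnegative orthant are relevant. *)
Definition conservative_pds (q : nat) p d : Prop :=
  [/\ forall k nu y, nonneg_mx y -> 0 <= p k nu y /\ 0 <= d k nu y,
      forall k nu y, p k nu y = d nu k y,
      forall k y, p k k y = 0 /\ d k k y = 0,
      forall nu, [lipschitz pds_part p d nu y | y in @nonneg_mx R 1 N] &
      forall nu, Ck q (@positive_mx R 1 N) (pds_part p d nu)].

End PDS.

Section RungeKutta.
Variables (R : realType) (s : nat).
Implicit Types (A : 'M[R]_s) (b : 'rV[R]_s).

(* One step of size dt of the explicit additive Runge-Kutta scheme with
   coefficients a_ij w_i^[nu] and b_j v^[nu] for y' = sum_nu F^[nu](y). *)
Definition additive_rk_step (K m : nat) A b
    (w : 'I_s -> 'I_K -> R) (v : 'I_K -> R)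
    (F : 'I_K -> 'rV[R]_m -> 'rV[R]_m) (dt : R) (y0 : 'rV[R]_m)
    (Z : 'M[R]_(s, m)) (znew : 'rV[R]_m) : Prop :=
  (forall i : 'I_s, row i Z = y0 +
     dt *: \sum_(j < s | (j < i)%N) A i j *: \sum_nu w i nu *: F nu (row j Z))
  /\ znew = y0 + dt *: \sum_(j < s) b 0 j *: \sum_nu v nu *: F nu (row j Z).

(* The explicit Runge-Kutta scheme (A, b) has order at least q: one component
   and unit weights. *)
Definition rk_order (q : nat) A b : Prop :=
  forall (m : nat) (F : 'rV[R]_m -> 'rV[R]_m) (tn T : R) (yn : 'rV[R]_m)
         (y : R -> 'rV[R]_m) (Z : R -> 'M[R]_(s, m)) (znew : R -> 'rV[R]_m),
  Ck q.+1 setT F -> 0 < T -> ivp_solution F tn T yn y ->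
  (forall dt, 0 <= dt ->
     additive_rk_step A b (fun _ _ => 1) (fun _ => 1) (fun _ : 'I_1 => F)
       dt yn (Z dt) (znew dt)) ->
  forall k, bigO_dt q.+1 (fun dt => znew dt 0 k - y (tn + dt) 0 k).

End RungeKutta.

Section MPRK.
Variables (R : realType) (s N : nat).

(* pi i yn Y holds the denominators of stage i, sigma dt yn Y those of the
   final update. *)
Definition stage_denominators := 'I_s -> 'rV[R]_N -> 'M[R]_(s, N) -> 'rV[R]_N.
Definition final_denominators := R -> 'rV[R]_N -> 'M[R]_(s, N) -> 'rV[R]_N.

Implicit Types (A : 'M[R]_s) (b : 'rV[R]_s) (p d : 'I_N -> 'I_N -> 'rV[R]_N -> R).
Implicit Types (pi : stage_denominators) (sigma : final_denominators).

Definition admissible_stage_denominators pi : Prop :=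
  [/\ forall (i : 'I_s) yn Y, positive_mx yn -> positive_mx Y ->
        positive_mx (pi i yn Y),
      forall (i : 'I_s) yn Y Y',
        (forall j : 'I_s, (j < i)%N -> row j Y = row j Y') ->
        pi i yn Y = pi i yn Y' &
      forall i, {within [set u : 'rV[R]_N * 'M[R]_(s, N) |
                   positive_mx u.1 /\ positive_mx u.2],
                 continuous (fun u => pi i u.1 u.2)}].

(* sigma may also depend explicitly on dt, as it does when it is computed from
   an embedded linearly implicit step. *)
Definition admissible_final_denominators sigma : Prop :=
  (forall dt yn Y, 0 <= dt -> positive_mx yn -> positive_mx Y ->
     positive_mx (sigma dt yn Y)) /\
  {within [set u : R * 'rV[R]_N * 'M[R]_(s, N) |
     [/\ 0 <= u.1.1, positive_mx u.1.2 & positive_mx u.2]],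
   continuous (fun u => sigma u.1.1 u.1.2 u.2)}.

Definition mprk_step A b p d pi sigma (dt : R) (yn : 'rV[R]_N)
    (Y : 'M[R]_(s, N)) (ynew : 'rV[R]_N) : Prop :=
  (forall (i : 'I_s) (k : 'I_N),
     Y i k = yn 0 k + dt * \sum_(j < s | (j < i)%N) A i j *
       \sum_nu (p k nu (row j Y) * (Y i nu / pi i yn Y 0 nu)
              - d k nu (row j Y) * (Y i k / pi i yn Y 0 k)))
  /\
  (forall k : 'I_N,
     ynew 0 k = yn 0 k + dt * \sum_(j < s) b 0 j *
       \sum_nu (p k nu (row j Y) * (ynew 0 nu / sigma dt yn Y 0 nu)
              - d k nu (row j Y) * (ynew 0 k / sigma dt yn Y 0 k))).

(* Patankar weights along a family of MPRK steps, as functions of dt. *)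
Definition stage_weight pi yn (Y : R -> 'M[R]_(s, N)) (dt : R)
    (i : 'I_s) (nu : 'I_N) : R := Y dt i nu / pi i yn (Y dt) 0 nu.

Definition final_weight sigma yn (Y : R -> 'M[R]_(s, N))
    (ynew : R -> 'rV[R]_N) (dt : R) (nu : 'I_N) : R :=
  ynew dt 0 nu / sigma dt yn (Y dt) 0 nu.

(* The MPRK step is the additive Runge-Kutta step with coefficients
   a_ij y_nu^(i) / pi_nu^(i) and b_j y_nu^(n+1) / sigma_nu. *)
Lemma mprk_step_additive A b q p d pi sigma yn Y ynew (dt : R) :
  conservative_pds q p d ->
  mprk_step A b p d pi sigma dt yn (Y dt) (ynew dt) ->
  additive_rk_step A b (stage_weight pi yn Y dt)
    (final_weight sigma yn Y ynew dt) (pds_part p d) dt yn (Y dt) (ynew dt).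
Proof.
move=> [_ _ pkk _ _] [stageE newE].
have partE (x : 'I_N -> R) (y : 'rV[R]_N) k :
    \sum_nu (p k nu y * x nu - d k nu y * x k) =
    (\sum_nu x nu *: pds_part p d nu y) 0 k.
  rewrite summxE sumrB -big_distrl /=.
  rewrite [in RHS](bigD1 k) //= [X in X - _](bigD1 k) //= (pkk k y).1 mul0r add0r.
  rewrite !mxE eqxx mulrN [x k * _]mulrC addrC; congr (_ + _).
  apply: eq_bigr => nu nuk; rewrite !mxE.
  by rewrite eq_sym (negbTE nuk) mulrC.
split=> [i|].
  apply/rowP => k; rewrite [LHS]mxE stageE !mxE summxE.
  by congr (_ + _ * _); apply: eq_bigr => j _; rewrite partE [in RHS]mxE.
apply/rowP => k; rewrite newE !mxE summxE.
by congr (_ + _ * _); apply: eq_bigr => j _; rewrite partE [in RHS]mxE.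
Qed.

(* Order at least q at yn, for arbitrary right-hand sides: the scheme, read as
   an additive Runge-Kutta method whose coefficients are functions of dt, has
   one-step error O(dt^(q+1)) for every conservative PDS of the class. Testing
   the given coefficients against all PDS is what makes the elementary
   differentials independent. Testing only the PDS that produced the weights
   would not do: the columns f^[nu] of a conservative PDS all sum to 0, so they
   are linearly dependent, and the final weights can be moved along a kernel
   vector of sum_j b_j (f^[1] ... f^[N])(y^(j)) without changing y^(n+1). *)
Definition mprk_order (q : nat) A b pi sigma (yn : 'rV[R]_N)
    (Y : R -> 'M[R]_(s, N)) (ynew : R -> 'rV[R]_N) : Prop :=
  forall p d (tn T : R) (y : R -> 'rV[R]_N)
         (Z : R -> 'M[R]_(s, N)) (znew : R -> 'rV[R]_N),
  conservative_pds q.+1 p d -> 0 < T ->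
  ivp_solution (pds_rhs p d) tn T yn y ->
  (forall dt, 0 <= dt ->
     additive_rk_step A b (stage_weight pi yn Y dt)
       (final_weight sigma yn Y ynew dt) (pds_part p d) dt yn (Z dt) (znew dt)) ->
  forall k, bigO_dt q.+1 (fun dt => znew dt 0 k - y (tn + dt) 0 k).

(* In particular, the MPRK approximation itself has one-step error
   O(dt^(q+1)). *)
Lemma mprk_order_error q A b p d pi sigma yn Y ynew tn T y :
  conservative_pds q.+1 p d ->
  (forall dt, 0 <= dt -> mprk_step A b p d pi sigma dt yn (Y dt) (ynew dt)) ->
  mprk_order q A b pi sigma yn Y ynew ->
  0 < T -> ivp_solution (pds_rhs p d) tn T yn y ->
  forall k, bigO_dt q.+1 (fun dt => ynew dt 0 k - y (tn + dt) 0 k).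
Proof.
move=> pdsP stepP ordP T0 yP; apply: (ordP _ _ _ _ _ _ _ pdsP T0 yP) => dt dt0.
exact: mprk_step_additive pdsP (stepP dt dt0).
Qed.

End MPRK.

(* Main.v *)
Require Import Defs.
From HB Require Import structures.
From mathcomp Require Import all_boot all_order all_algebra.
From mathcomp Require Import all_classical all_reals all_analysis.
From mathcomp Require Import ring lra.

Set Implicit Arguments.
Unset Strict Implicit.
Unset Printing Implicit Defensive.

Import Order.TTheory GRing.Theory Num.Theory.
Import numFieldNormedType.Exports.
Local Open Scope classical_set_scope.
Local Open Scope ring_scope.

(** The scheme is an additive Runge-Kutta step whose coefficients are multiplied by
    the weights [w_i = y^(i) / pi^(i)] and [v = y^(n+1) / sigma], which depend on the
    step size. Expanding this step and the exact solution in powers of [dt] and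
    comparing elementary differentials, order 3 holds for all systems if and only if,
    besides the conditions on the underlying scheme,
      [v = 1 + O(dt^3)], [sum_i b_i c_i w_i = 1/2 + O(dt^2)], [w_i = 1 + O(dt)].
    The three conditions of the theorem are these, translated from the weights to the
    denominators.

    That the conditions on the weights suffice is [additive_rk_taylor3] together with
    [ivp_solution_taylor3]: both expansions only use that each part agrees near [y^n]
    with its quadratic Taylor polynomial up to a cubic remainder ([Ck_taylor]). The
    mean [sum_i b_i y^(i)] is the only place where the first-order terms of the stage
    weights are seen, and they enter through the quadrature sum
    ([stages_mean_bigO3]).

    Conversely, the order is tested on reactions between two species
    ([mprk_order_scalar]), which reduce to scalar equations with constant, linear and
    exponential rates. These give, for each species separately,
      [v = 1 + O(dt^3)], [sum_i b_i c_i w_i = 1/2 + O(dt^2)],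
      [w_2 w_3 = 1 + O(dt)], [sum_i b_i c_i^2 w_i^2 = 1/3 + O(dt)]
    ([scalar_order_conditions]). To conclude that [w_i = 1 + O(dt)], observe that the
    denominators of the second stage are functions of [y^n] alone, hence constants;
    by positivity and conservation of the Patankar step ([patankar_system_gt0]) the
    stages are bounded, so that [w_2 = omega + O(dt)] with [omega > 0], and then
    [w_3 = 1 / omega + O(dt)]. The limits satisfy algebraic equations whose only
    solution with nonnegative coefficients is [omega = 1] ([limit_weight_eq1]). The
    same scalar tests yield the order conditions on the underlying scheme
    ([rk_order3_conditions]).

    Passing from the weights to the denominators is division by quantities bounded
    away from 0. In the other direction the final weights are recovered by a
    bootstrap: if [v = 1 + O(dt^q)] then [y^(n+1)] is known up to [O(dt^(q+1))], and
    so is [v = y^(n+1) / sigma]. *)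

(** * Asymptotic calculus as the step size tends to 0 *)

Section BigOCalculus.
Variable R : realType.
Implicit Types (e f g : R -> R) (q r : nat).

Lemma bigO_dtP q e :
  bigO_dt q e <-> exists C, \forall t \near 0^'+, `|e t| <= C * t ^+ q.
Proof.
split=> [/eqO_exP[C C0 He]|[C He]].
  exists C; near=> t.
  have t0 : 0 <= t by near: t; apply: nbhs_right_ge.
  have : `|e t| <= C * `|t ^+ q| by near: t.
  by rewrite normrX (ger0_norm t0).
apply/eqO_exP; exists (`|C| + 1); first by rewrite ltr_wpDl.
near=> t.
have t0 : 0 <= t by near: t; apply: nbhs_right_ge.
rewrite normrX (ger0_norm t0).
apply: le_trans (_ : C * t ^+ q <= _); first by near: t.
rewrite ler_wpM2r ?exprn_ge0 // (le_trans (ler_norm _)) // lerDl //.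
Unshelve. all: by end_near. Qed.

Lemma eq_bigO q e f : e =1 f -> bigO_dt q e -> bigO_dt q f.
Proof. by move=> /funext->. Qed.

Lemma near_eq_bigO q e f :
  (\forall t \near 0^'+, e t = f t) -> bigO_dt q e -> bigO_dt q f.
Proof.
move=> ef /bigO_dtP[C He]; apply/bigO_dtP; exists C; near=> t.
by rewrite -(near ef t) //; near: t.
Unshelve. all: by end_near. Qed.

Lemma bigO_bound q C e :
  (\forall t \near 0^'+, `|e t| <= C * t ^+ q) -> bigO_dt q e.
Proof. by move=> He; apply/bigO_dtP; exists C. Qed.

Lemma bigO_weaken r q e : (q <= r)%N -> bigO_dt r e -> bigO_dt q e.
Proof.
move=> qr /bigO_dtP[C He]; apply: (@bigO_bound _ `|C|); near=> t.
have t0 : 0 <= t by near: t; apply: nbhs_right_ge.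
have t1 : t <= 1 by near: t; apply: nbhs_right_le.
apply: le_trans (_ : C * t ^+ r <= _); first by near: t.
apply: le_trans (_ : `|C| * t ^+ r <= _).
  by rewrite ler_wpM2r ?exprn_ge0 ?ler_norm.
by rewrite ler_wpM2l // ler_wiXn2l.
Unshelve. all: by end_near. Qed.

Lemma bigOD q e f : bigO_dt q e -> bigO_dt q f -> bigO_dt q (fun t => e t + f t).
Proof.
move=> /bigO_dtP[C He] /bigO_dtP[D Hf]; apply: (@bigO_bound _ (C + D)); near=> t.
rewrite (le_trans (ler_normD _ _)) // mulrDl lerD //; by near: t.
Unshelve. all: by end_near. Qed.

Lemma bigON q e : bigO_dt q e -> bigO_dt q (fun t => - e t).
Proof.
by move=> /bigO_dtP[C He]; apply: (@bigO_bound _ C); apply: filterS He => t; rewrite normrN.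
Qed.

Lemma bigOB q e f : bigO_dt q e -> bigO_dt q f -> bigO_dt q (fun t => e t - f t).
Proof. by move=> He Hf; apply: bigOD => //; apply: bigON. Qed.

Lemma bigOM q r e f :
  bigO_dt q e -> bigO_dt r f -> bigO_dt (q + r) (fun t => e t * f t).
Proof.
move=> /bigO_dtP[C He] /bigO_dtP[D Hf]; apply: (@bigO_bound _ (C * D)); near=> t.
rewrite normrM exprD mulrACA ler_pM //; by near: t.
Unshelve. all: by end_near. Qed.

Lemma bigOXn q : bigO_dt q (fun t : R => t ^+ q).
Proof.
apply: (@bigO_bound _ 1); near=> t; rewrite mul1r ger0_norm //.
by rewrite exprn_ge0 //; near: t; apply: nbhs_right_ge.
Unshelve. all: by end_near. Qed.

Lemma bigO_id : bigO_dt 1 (fun t : R => t).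
Proof. exact: bigOXn. Qed.

Lemma bigO_cst (c : R) : bigO_dt 0 (fun=> c).
Proof. by apply: (@bigO_bound _ `|c|); apply: nearW => t; rewrite expr0 mulr1.
Qed.

Lemma bigO0 q : bigO_dt q (fun=> 0 : R).
Proof.
by apply: (@bigO_bound _ 0); apply: nearW => t; rewrite normr0 mul0r.
Qed.

Lemma bigOMr q e f : bigO_dt q e -> bigO_dt 0 f -> bigO_dt q (fun t => e t * f t).
Proof. by move=> He Hf; rewrite -[q]addn0; apply: bigOM. Qed.

Lemma bigOMl q e f : bigO_dt 0 f -> bigO_dt q e -> bigO_dt q (fun t => f t * e t).
Proof. by move=> Hf He; apply: (bigOM Hf He). Qed.

Lemma bigOZ q (c : R) e : bigO_dt q e -> bigO_dt q (fun t => c * e t).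
Proof. by move=> He; apply: bigOMl => //; apply: bigO_cst. Qed.

Lemma bigO_id_mul q e : bigO_dt q e -> bigO_dt q.+1 (fun t => t * e t).
Proof. by move=> He; apply: (bigOM bigO_id He). Qed.

Lemma bigO_sum q (I : Type) (s : seq I) (P : pred I) (F : I -> R -> R) :
  (forall i, P i -> bigO_dt q (F i)) ->
  bigO_dt q (fun t => \sum_(i <- s | P i) F i t).
Proof.
move=> HF; elim: s => [|i s IH].
  by apply: (eq_bigO _ (@bigO0 q)) => t; rewrite big_nil.
have [Pi|nPi] := boolP (P i); last first.
  by apply: (eq_bigO _ IH) => t; rewrite big_cons (negbTE nPi).
by apply: (eq_bigO _ (bigOD (HF i Pi) IH)) => t; rewrite big_cons Pi.
Qed.

Lemma bigO_Xn_cancel r q e : bigO_dt (r + q) (fun t => t ^+ r * e t) -> bigO_dt q e.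
Proof.
move=> /bigO_dtP[C He]; apply: (@bigO_bound _ C); near=> t.
have t0 : 0 < t by near: t; apply: nbhs_right_gt.
have : `|t ^+ r * e t| <= C * t ^+ (r + q) by near: t.
by rewrite normrM gtr0_norm ?exprn_gt0 // exprD mulrCA ler_pM2l // exprn_gt0.
Unshelve. all: by end_near. Qed.

Lemma bigO1_lt e (c : R) : 0 < c -> bigO_dt 1 e -> \forall t \near 0^'+, `|e t| < c.
Proof.
move=> c0 /bigO_dtP[C He]; near=> t.
have t0 : 0 <= t by near: t; apply: nbhs_right_ge.
apply: le_lt_trans (_ : C * t ^+ 1 < _); first by near: t.
apply: le_lt_trans (_ : (`|C| + 1) * t < _).
  by rewrite expr1 ler_wpM2r // (le_trans (ler_norm _)) // lerDl.
rewrite mulrC -ltr_pdivlMr ?ltr_wpDl //.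
by near: t; apply: nbhs_right_lt; rewrite divr_gt0 ?ltr_wpDl.
Unshelve. all: by end_near. Qed.

Lemma bigO1_cst_eq0 (c : R) : bigO_dt 1 (fun=> c) -> c = 0.
Proof.
move=> Hc; apply/eqP/negP => /negP c0.
have := @bigO1_lt _ `|c| _ Hc; rewrite normr_gt0 => /(_ c0) [d /= d0 /(_ (d / 2))].
rewrite /= sub0r normrN ger0_norm ?divr_ge0 ?ltW // ltxx.
by move=> H; have : false by apply: H; rewrite ?divr_gt0 //; lra.
Qed.

Lemma bigO_inv (c : R) g : c != 0 -> bigO_dt 1 (fun t => g t - c) ->
  bigO_dt 0 (fun t => (g t)^-1).
Proof.
move=> c0 Hg; have c1 : 0 < `|c| by rewrite normr_gt0.
apply: (@bigO_bound _ (2 / `|c|)); near=> t.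
have : `|g t - c| < `|c| / 2.
  by near: t; apply: bigO1_lt => //; rewrite divr_gt0.
have := ler_normD (g t) (c - g t).
rewrite addrCA subrr addr0 [`|c - _|]distrC => h1 h2.
have h : `|c| / 2 <= `|g t| by lra.
rewrite expr0 mulr1 normfV -[2 / _]invrK invf_div lef_pV2 // posrE.
  by rewrite (lt_le_trans _ h) ?divr_gt0.
by rewrite divr_gt0.
Unshelve. all: by end_near. Qed.

Lemma bigO_inv_near (c : R) g : c != 0 -> bigO_dt 1 (fun t => g t - c) ->
  \forall t \near 0^'+, g t != 0.
Proof.
move=> c0 Hg; near=> t; apply/eqP => gt0.
have : `|g t - c| < `|c| by near: t; apply: bigO1_lt => //; rewrite normr_gt0.
by rewrite gt0 sub0r normrN ltxx.
Unshelve. all: by end_near. Qed.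

(** By the mean value theorem. The derivative is only used to the right of [t0], in
    agreement with the notion of solution of an initial value problem. *)
Lemma bigO_integrate q (h dh : R -> R) (t0 T : R) : 0 < T ->
  h t @[t --> t0^'+] --> h t0 ->
  (forall t, t0 < t < t0 + T -> is_derive t 1 h (dh t)) ->
  bigO_dt q (fun s => dh (t0 + s)) ->
  bigO_dt q.+1 (fun s => h (t0 + s) - h t0).
Proof.
move=> T0 hcont hder /bigO_dtP[C [d /= d0 HC]].
apply: (@bigO_bound _ `|C|); near=> s.
have s0 : 0 < s by near: s; apply: nbhs_right_gt.
have sT : s < T by near: s; apply: nbhs_right_lt.
have sd : s < d by near: s; apply: nbhs_right_lt.
have lt_t0s : t0 < t0 + s by rewrite ltrDl.
have [x| |x xs ->] := @MVT _ h dh t0 (t0 + s) lt_t0s.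
- rewrite in_itv /= => /andP[t0x xs]; apply: hder; rewrite t0x /=; lra.
- apply/continuous_within_itvP => //; split => //.
    move=> x; rewrite in_itv /= => /andP[t0x xs].
    have hx : derivable h x 1 by have [] := hder x _; [lra|].
    by apply: differentiable_continuous; apply/derivable1_diffP.
  apply: cvg_at_left_filter.
  have hx : derivable h (t0 + s) 1 by have [] := hder (t0 + s) _; [lra|].
  by apply: differentiable_continuous; apply/derivable1_diffP.
move: xs; rewrite in_itv /= => /andP[t0x xs].
have x0 : 0 < x - t0 by rewrite subr_gt0.
have xs' : x - t0 < s by lra.
have := HC (x - t0); rewrite /= sub0r normrN gtr0_norm // addrCA subrr addr0.
move=> /(_ (lt_trans xs' sd) x0) Hx.
rewrite addrAC subrr add0r normrM (gtr0_norm s0) exprSr mulrA ler_wpM2r ?(ltW s0) //.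
apply: (le_trans Hx); apply: le_trans (_ : `|C| * (x - t0) ^+ q <= _).
  by rewrite ler_wpM2r ?exprn_ge0 ?ler_norm // ltW.
by rewrite ler_wpM2l // lerXn2r ?nnegrE // ?ltW.
Unshelve. all: by end_near. Qed.

End BigOCalculus.

(** * Taylor expansion of maps of class C^q *)

Section Taylor.
Variables (R : realType) (m n : nat).
Implicit Types (U : set 'rV[R]_m) (f : 'rV[R]_m -> 'rV[R]_n) (y u : 'rV[R]_m).

Lemma nbhs_rV_box y U : nbhs y U ->
  exists2 r : R, 0 < r & forall u, (forall i, `|u 0 i| < r) -> U (y + u).
Proof.
move=> /nbhs_ballP[r /= r0 Ur]; exists r => // u ur; apply: Ur; split => // i j.
by rewrite /ball /= [i]ord1 !mxE opprD addrA subrr sub0r normrN.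
Qed.

Lemma CkW q U f : Ck q.+1 U f -> Ck q U f.
Proof.
elim: q f => [|q IH] f [dU DU]; first by move=> y Uy; apply/differentiable_continuous/dU.
by split => // i; apply: IH; exact: DU.
Qed.

Lemma derive_row_sum f y u : differentiable f y ->
  'D_u f y = \sum_i u 0 i *: 'D_(delta_mx 0 i) f y.
Proof.
move=> df; rewrite deriveE // {1}(row_sum_delta u) linear_sum.
by apply: eq_bigr => i _; rewrite linearZ deriveE.
Qed.

Lemma is_derive_segment f y u (t : R) k : differentiable f (y + t *: u) ->
  is_derive t 1 (fun t => f (y + t *: u) 0 k)
    (\sum_i u 0 i * 'D_(delta_mx 0 i) f (y + t *: u) 0 k).
Proof.
move=> df; pose g (s : R) := f (y + s *: u).
have quotE : (fun h : R => h^-1 *: ((g \o shift t) (h *: 1) - g t)) =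
    (fun h : R => h^-1 *: ((f \o shift (y + t *: u)) (h *: u) - f (y + t *: u))).
  by apply/funext => h; rewrite /g /= [h *: 1]mulr1 scalerDl addrCA.
have dg : derivable g t 1 by rewrite /derivable quotE; exact: diff_derivable.
have Dg : 'D_1 g t = 'D_u f (y + t *: u) by rewrite /derive quotE.
have := derive_mx dg; rewrite Dg derive_row_sum // => /rowP/(_ k).
rewrite summxE !mxE => Dgk; apply: DeriveDef; first exact: ((derivable_mxP _ _ _).1 dg 0 k).
by rewrite -Dgk; apply: eq_bigr => i _; rewrite mxE.
Qed.

(** The homogeneous part of degree [j] of the Taylor expansion at [y] of the
    component [k] of [f]. The recursion on first partial derivatives follows the
    definition of [Ck]; the factor [1 / j] comes from integrating [t ^+ j.-1] along
    the segment from [y] to [y + u]. *)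
Fixpoint taylor_term (k : 'I_n) y (j : nat) f u : R :=
  match j with
  | 0%N => f y 0 k
  | j'.+1 => j'.+1%:R^-1 *
      \sum_i u 0 i * taylor_term k y j' (fun z => 'D_(delta_mx 0 i) f z) u
  end.

Lemma taylor_termZ k y j f u (t : R) :
  taylor_term k y j f (t *: u) = t ^+ j * taylor_term k y j f u.
Proof.
elim: j f => [|j IH] f /=; first by rewrite mul1r.
rewrite [RHS]mulrCA; congr (_ * _); rewrite big_distrr /=.
by apply: eq_bigr => i _; rewrite IH mxE exprS; ring.
Qed.

Lemma is_derive_powers q (c : nat -> R) (t : R) :
  is_derive t 1 (fun t => \sum_(j < q.+1) t ^+ j * c j)
    (\sum_(j < q) t ^+ j * (j.+1%:R * c j.+1)).
Proof.
elim: q => [|q IH].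
  rewrite big_ord0 (_ : (fun _ => _) = cst (c 0%N)); first exact: is_derive_cst.
  by apply/funext => s; rewrite big_ord1 mul1r.
have -> : (fun t => \sum_(j < q.+2) t ^+ j * c j) =
    (fun t => \sum_(j < q.+1) t ^+ j * c j) + c q.+1 *: (id ^+ q.+1 : R -> R).
  apply/funext => s; rewrite big_ord_recr /= addrfctE scalrfctE exprfctE.
  by rewrite [c _ *: _]mulrC.
rewrite big_ord_recr /=; apply: is_derive_eq.
by congr (_ + _); rewrite /GRing.scale /=; ring.
Qed.

(** Along a segment, the derivative of the remainder of order [q + 1] is a
    combination of the remainders of order [q] of the partial derivatives, so that
    the mean value theorem gains one power of the radius. The bound is uniform over
    a cube, in order to apply to increments that depend on the step size. *)
Lemma Ck_taylor q U f y k : nbhs y U -> Ck q U f ->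
  exists C, \forall r \near 0^'+, forall u, (forall i, `|u 0 i| <= r) ->
    `|f (y + u) 0 k - \sum_(j < q) taylor_term k y j f u| <= C * r ^+ q.
Proof.
move=> yU; elim: q f => [|q IH] f /=.
  move=> cf; have /cf fy : U y by exact: nbhs_singleton.
  have : \forall z \near y, `|f z 0 k| <= `|f y 0 k| + 1.
    have fk : (fun z => f z 0 k) @ y --> f y 0 k.
      exact: (continuous_comp fy (@coord_continuous R 1 n 0 k (f y))).
    have /cvgrPdist_le/(_ 1 ltr01) := fk; apply: filterS => z fz.
    by rewrite -lerBlDl (le_trans (lerB_dist _ _)) // distrC.
  move=> /nbhs_rV_box[d d0 dU]; exists (`|f y 0 k| + 1); near=> r => u ur.
  rewrite big_ord0 subr0 mulr1; apply: dU => i; apply: le_lt_trans (ur i) _.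
  by near: r; apply: nbhs_right_lt.
move=> [df Df].
have /choice[C HC] : forall i : 'I_m, exists C, \forall r \near 0^'+,
    forall u, (forall i, `|u 0 i| <= r) ->
      `|'D_(delta_mx 0 i) f (y + u) 0 k - \sum_(j < q)
         taylor_term k y j (fun z => 'D_(delta_mx 0 i) f z) u| <= C * r ^+ q.
  by move=> i; apply: IH; exact: Df.
have [d d0 dU] := nbhs_rV_box yU.
exists (\sum_i C i); near=> r => u ur.
have r0 : 0 < r by near: r; apply: nbhs_right_gt.
have tur (t : R) : t \in `[0, 1] -> forall i, `|(t *: u) 0 i| <= r.
  rewrite in_itv /= => /andP[t0 t1] i.
  by rewrite mxE normrM (ger0_norm t0) (le_trans _ (ur i)) // ler_piMl.
have tuU (t : R) : t \in `[0, 1] -> U (y + t *: u).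
  move=> tI; apply: dU => i; apply: le_lt_trans (tur t tI i) _.
  by near: r; apply: nbhs_right_lt.
pose h (t : R) := f (y + t *: u) 0 k -
  \sum_(j < q.+1) t ^+ j * taylor_term k y j f u.
pose dh (t : R) := \sum_i u 0 i * ('D_(delta_mx 0 i) f (y + t *: u) 0 k -
  \sum_(j < q) taylor_term k y j (fun z => 'D_(delta_mx 0 i) f z) (t *: u)).
have hder (t : R) : t \in `[0, 1] -> is_derive t 1 h (dh t).
  move=> tI.
  have := is_deriveB (is_derive_segment k (df _ (tuU t tI)))
                     (is_derive_powers q (fun j => taylor_term k y j f u) t).
  move=> H; apply: is_derive_eq; rewrite /dh /=.
  rewrite (eq_bigr (fun j : 'I_q => \sum_i u 0 i * taylor_term k y j
    (fun z => 'D_(delta_mx 0 i) f z) (t *: u))) => [|j _].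
    by rewrite exchange_big /= -sumrB; apply: eq_bigr => i _; rewrite mulrBr big_distrr.
  rewrite mulVKf ?pnatr_eq0 // big_distrr /=; apply: eq_bigr => i _.
  by rewrite taylor_termZ; ring.
have hder' : forall x : R, x \in `]0, 1[%R -> is_derive x 1 h (dh x).
  by move=> x xI; apply: hder; exact: subset_itv_oo_cc.
have hcont : {within `[0, 1], continuous h}.
  by apply: derivable_within_continuous => x /hder[].
have [t tI] := @MVT_segment R h dh 0 1 (@ler01 R) hder' hcont.
have -> : h 0 = 0.
  rewrite /h scale0r addr0 big_ord_recl big1 ?addr0 /= ?mul1r ?subrr // => j _.
  by rewrite exprS !mul0r.
have -> : h 1 = f (y + u) 0 k - \sum_(j < q.+1) taylor_term k y j f u.
  rewrite /h scale1r; congr (_ - _).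
  by apply: eq_bigr => j _; rewrite expr1n mul1r.
rewrite !subr0 mulr1 => ->; rewrite /dh (le_trans (ler_norm_sum _ _ _)) //.
rewrite exprS mulrCA mulrA big_distrr /= big_distrl /=; apply: ler_sum => i _.
rewrite normrM -mulrA ler_pM // ?ur //.
suff : forall i u, (forall j, `|u 0 j| <= r) ->
      `|'D_(delta_mx 0 i) f (y + u) 0 k - \sum_(j < q)
         taylor_term k y j (fun z => 'D_(delta_mx 0 i) f z) u| <= C i * r ^+ q.
  by apply; exact: tur.
by near: r; apply: filter_forall => j; exact: HC.
Unshelve. all: by end_near. Qed.

End Taylor.

(** * Composition with small increments and the exact solution *)

Section RowEntries.
Variables (R : realType) (n : nat).
Implicit Types a b : 'rV[R]_n.

Lemma row_entryD a b k : (a + b) 0 k = a 0 k + b 0 k. Proof. by rewrite mxE. Qed.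
Lemma row_entryN a k : (- a) 0 k = - a 0 k. Proof. by rewrite mxE. Qed.
Lemma row_entryZ (x : R) a k : (x *: a) 0 k = x * a 0 k. Proof. by rewrite mxE. Qed.
Lemma row_entry0 k : (0 : 'rV[R]_n) 0 k = 0. Proof. by rewrite mxE. Qed.

(* Unlike [mxE], these rules leave matrix products folded. *)
Definition row_entryE := (row_entryD, row_entryN, row_entryZ, row_entry0).

End RowEntries.

Section Composition.
Variables (R : realType) (m n : nat) (U : set 'rV[R]_m) (y : 'rV[R]_m).
Hypothesis yU : nbhs y U.
Implicit Types (F : 'rV[R]_m -> 'rV[R]_n) (u : R -> 'rV[R]_m) (k : 'I_n).

Lemma bigO_mulmx q u (M : 'M[R]_(m, n)) k :
  (forall i, bigO_dt q (fun t => u t 0 i)) ->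
  bigO_dt q (fun t => (u t *m M) 0 k).
Proof.
move=> uq; apply: (@eq_bigO _ _ (fun t => \sum_i u t 0 i * M i k)).
  by move=> t; rewrite mxE.
by apply: bigO_sum => i _; apply: bigOMr => //; exact: bigO_cst.
Qed.

Lemma bigO_taylor q F u k : Ck q U F ->
  (forall i, bigO_dt 1 (fun t => u t 0 i)) ->
  bigO_dt q (fun t => F (y + u t) 0 k - \sum_(j < q) taylor_term k y j F (u t)).
Proof.
move=> CF u1; have [C [d /= d0 HC]] := Ck_taylor k yU CF.
have /choice[K HK] : forall i, exists K, \forall t \near 0^'+, `|u t 0 i| <= K * t ^+ 1.
  by move=> i; exact/bigO_dtP.
pose L := 1 + \sum_i `|K i|.
have L0 : 0 < L by rewrite ltr_wpDr // sumr_ge0.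
have HL : \forall t \near 0^'+, forall i, `|u t 0 i| <= L * t.
  apply: filter_forall => i; near=> t.
  have t0 : 0 <= t by near: t; apply: nbhs_right_ge.
  apply: le_trans (_ : K i * t ^+ 1 <= _); first by near: t; exact: HK.
  rewrite expr1 ler_wpM2r // (le_trans (ler_norm _)) // /L (bigD1 i) //=.
  by rewrite addrCA lerDl addr_ge0 // sumr_ge0.
apply: (@bigO_bound _ _ (C * L ^+ q)); near=> t.
have t0 : 0 < t by near: t; apply: nbhs_right_gt.
have Lt0 : 0 < L * t by rewrite mulr_gt0.
rewrite -mulrA -exprMn; apply: HC => //.
  rewrite /= sub0r normrN gtr0_norm // mulrC -ltr_pdivlMr //.
  by near: t; apply: nbhs_right_lt; rewrite divr_gt0.
by near: t.
Unshelve. all: by end_near. Qed.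

Lemma bigO_taylor_term_lead j F u (a : 'rV[R]_m) k :
  (forall i, bigO_dt 1 (fun t => u t 0 i)) ->
  (forall i, bigO_dt 2 (fun t => u t 0 i - t * a 0 i)) ->
  bigO_dt j.+1
    (fun t => taylor_term k y j F (u t) - t ^+ j * taylor_term k y j F a).
Proof.
move=> u1 u2; elim: j F => [|j IH] F /=.
  by apply: (eq_bigO _ (@bigO0 _ _)) => t; rewrite mul1r subrr.
pose D i := fun z => 'D_(delta_mx 0 i) F z.
apply: (@eq_bigO _ _ (fun t => j.+1%:R^-1 * \sum_i
   (u t 0 i * (taylor_term k y j (D i) (u t) - t ^+ j * taylor_term k y j (D i) a)
    + (u t 0 i - t * a 0 i) * (t ^+ j * taylor_term k y j (D i) a)))).
  move=> t; rewrite [X in _ - X]mulrCA -mulrBr; congr (_ * _).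
  by rewrite big_distrr -sumrB; apply: eq_bigr => i _ /=; rewrite /D exprS; ring.
apply: bigOZ; apply: bigO_sum => i _; apply: bigOD; first exact: (bigOM (u1 i) (IH _)).
by apply: (bigOM (u2 i)); apply: bigOMr; [exact: bigOXn|exact: bigO_cst].
Qed.

Lemma taylor_term1 F k (v : 'rV[R]_m) : differentiable F y ->
  taylor_term k y 1 F v = (v *m 'J F y) 0 k.
Proof.
move=> dF; rewrite /= invr1 mul1r /jacobian mul_rV_lin1 -deriveE //.
by rewrite derive_row_sum // summxE; apply: eq_bigr => i _; rewrite mxE.
Qed.

Lemma Ck_comp1 F u k : Ck 1 U F -> (forall i, bigO_dt 1 (fun t => u t 0 i)) ->
  bigO_dt 1 (fun t => F (y + u t) 0 k - F y 0 k).
Proof.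
move=> CF u1; apply: (eq_bigO _ (bigO_taylor k CF u1)) => t.
by rewrite big_ord1.
Qed.

Lemma Ck_comp2 F u k : Ck 2 U F -> (forall i, bigO_dt 1 (fun t => u t 0 i)) ->
  bigO_dt 2 (fun t => F (y + u t) 0 k - F y 0 k - (u t *m 'J F y) 0 k).
Proof.
move=> CF u1; apply: (eq_bigO _ (bigO_taylor k CF u1)) => t.
rewrite big_ord_recr big_ord1 taylor_term1 /= ?opprD ?addrA //.
by apply: (CF.1); exact: nbhs_singleton.
Qed.

Lemma Ck_comp3 F u (a : 'rV[R]_m) k : Ck 3 U F ->
  (forall i, bigO_dt 1 (fun t => u t 0 i)) ->
  (forall i, bigO_dt 2 (fun t => u t 0 i - t * a 0 i)) ->
  bigO_dt 3 (fun t => F (y + u t) 0 k - F y 0 k - (u t *m 'J F y) 0 k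
                      - t ^+ 2 * taylor_term k y 2 F a).
Proof.
move=> CF u1 u2.
apply: (eq_bigO _ (bigOD (bigO_taylor k CF u1) (bigO_taylor_term_lead 2 F k u1 u2))).
move=> t; rewrite 2!big_ord_recr big_ord1 taylor_term1 //=; first by ring.
by apply: (CF.1); exact: nbhs_singleton.
Qed.

End Composition.

Arguments taylor_term : simpl never.

Section ExactSolution.
Variables (R : realType) (m : nat).
Implicit Types (F : 'rV[R]_m -> 'rV[R]_m).

Lemma is_derive_coord (y : R -> 'rV[R]_m) (v : 'rV[R]_m) (t : R) k :
  is_derive t 1 y v -> is_derive t 1 (fun t => y t 0 k) (v 0 k).
Proof.
move=> [dy yv]; apply: DeriveDef; first exact: ((derivable_mxP _ _ _).1 dy 0 k).
by rewrite -yv derive_mx // mxE.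
Qed.

Lemma cvg_row_coord (T : Type) (G : set_system T) (FG : Filter G)
    (y : T -> 'rV[R]_m) (v : 'rV[R]_m) k :
  y t @[t --> G] --> v -> y t 0 k @[t --> G] --> v 0 k.
Proof.
move=> yv; have ck : {for v, continuous (fun w : 'rV[R]_m => w 0 k)}.
  exact: coord_continuous.
exact: (continuous_cvg _ ck yv).
Qed.

Lemma cvg_bigO0 (g : R -> R) (l : R) : g t @[t --> 0^'+] --> l -> bigO_dt 0 g.
Proof.
move=> /cvgrPdist_le/(_ 1 ltr01) gl; apply: (@bigO_bound _ _ (`|l| + 1)).
apply: filterS gl => t glt.
by rewrite mulr1 -lerBlDl (le_trans (lerB_dist _ _)) // distrC.
Qed.

End ExactSolution.

Section Splitting.
Variables (R : realType) (m K : nat) (U : set 'rV[R]_m) (yn : 'rV[R]_m).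
Variable F : 'I_K -> 'rV[R]_m -> 'rV[R]_m.
Hypotheses (ynU : nbhs yn U) (CF : forall nu, Ck 3 U (F nu)).
Implicit Types (u : R -> 'rV[R]_m) (k : 'I_m) (nu : 'I_K).

Definition split_rhs (z : 'rV[R]_m) := \sum_nu F nu z.
Definition split_jacobian := \sum_nu 'J (F nu) yn.

(** Half the second differential of [split_rhs] at [yn], applied to [(a, a)]. It is
    summed over the parts, so that only their partial derivatives of order 2 occur. *)
Definition split_quad k (a : 'rV[R]_m) := \sum_nu taylor_term k yn 2 (F nu) a.

Local Notation f := (split_rhs yn).
Local Notation J := split_jacobian.

(** The Taylor polynomial of degree 3 of the solution of [y' = split_rhs y] issued
    from [yn], written with elementary differentials. *)
Definition solution_taylor3 k (t : R) : R :=
  yn 0 k + t * f 0 k + t ^+ 2 / 2 * (f *m J) 0 k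
  + t ^+ 3 * ((f *m J *m J) 0 k / 6 + split_quad k f / 3).

Let differentiable_part nu : differentiable (F nu) yn.
Proof. by apply: (CF nu).1; exact: nbhs_singleton. Qed.

Let split_rhsE : split_rhs = \sum_nu F nu.
Proof. by apply/funext => z; rewrite fct_sumE. Qed.

Let differentiable_split_rhs : differentiable split_rhs yn.
Proof. by rewrite split_rhsE; exact: differentiable_sum. Qed.

Lemma jacobian_split_rhs : 'J split_rhs yn = J.
Proof.
apply/row_matrixP => i; rewrite !rowE /J /jacobian mul_rV_lin1 -deriveE //.
rewrite split_rhsE derive_sum => [|nu]; last exact: diff_derivable.
rewrite mulmx_sumr; apply: eq_bigr => nu _.
by rewrite mul_rV_lin1 deriveE.
Qed.

Lemma split_comp1 u k : (forall i, bigO_dt 1 (fun t => u t 0 i)) ->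
  bigO_dt 1 (fun t => split_rhs (yn + u t) 0 k - f 0 k).
Proof.
move=> u1; apply: (@eq_bigO _ _ (fun t =>
    \sum_nu (F nu (yn + u t) 0 k - F nu yn 0 k))).
  by move=> t; rewrite !summxE sumrB.
by apply: bigO_sum => nu _; apply: (Ck_comp1 ynU k (CkW (CkW (CF nu))) u1).
Qed.

Lemma split_comp2 u k : (forall i, bigO_dt 1 (fun t => u t 0 i)) ->
  bigO_dt 2 (fun t => split_rhs (yn + u t) 0 k - f 0 k - (u t *m J) 0 k).
Proof.
move=> u1; apply: (@eq_bigO _ _ (fun t =>
    \sum_nu (F nu (yn + u t) 0 k - F nu yn 0 k - (u t *m 'J (F nu) yn) 0 k))).
  by move=> t; rewrite mulmx_sumr !summxE !sumrB.
by apply: bigO_sum => nu _; apply: (Ck_comp2 ynU k (CkW (CF nu)) u1).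
Qed.

Lemma split_comp3 u (a : 'rV[R]_m) k :
  (forall i, bigO_dt 1 (fun t => u t 0 i)) ->
  (forall i, bigO_dt 2 (fun t => u t 0 i - t * a 0 i)) ->
  bigO_dt 3 (fun t => split_rhs (yn + u t) 0 k - f 0 k - (u t *m J) 0 k
                      - t ^+ 2 * split_quad k a).
Proof.
move=> u1 u2; apply: (@eq_bigO _ _ (fun t =>
    \sum_nu (F nu (yn + u t) 0 k - F nu yn 0 k - (u t *m 'J (F nu) yn) 0 k
             - t ^+ 2 * taylor_term k yn 2 (F nu) a))).
  by move=> t; rewrite mulmx_sumr !summxE !sumrB /split_quad big_distrr.
by apply: bigO_sum => nu _; apply: (Ck_comp3 ynU k (CF nu) u1 u2).
Qed.

(** Picard iteration on expansions: an expansion of [y] gives one of [F(y)],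
    and integrating it gains one order. *)
Lemma ivp_solution_taylor3 (tn T : R) (y : R -> 'rV[R]_m) k :
  0 < T -> ivp_solution split_rhs tn T yn y ->
  bigO_dt 4 (fun t => y (tn + t) 0 k - solution_taylor3 k t).
Proof.
move=> T0 [ytn ycvg yder].
pose u (t : R) := y (tn + t) - yn.
have uE t : y (tn + t) = yn + u t by rewrite /u addrCA subrr addr0.
have integ q (a b c : 'rV[R]_m) : (forall k, bigO_dt q (fun t =>
      split_rhs (y (tn + t)) 0 k - (a 0 k + t * b 0 k + t ^+ 2 * c 0 k))) ->
    forall k, bigO_dt q.+1 (fun t =>
      u t 0 k - (t * a 0 k + t ^+ 2 * (b 0 k / 2) + t ^+ 3 * (c 0 k / 3))).
  move=> HF i.
  pose pol (t : R) := \sum_(j < 4) t ^+ j *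
    [:: 0; a 0 i; b 0 i / 2; c 0 i / 3]`_j.
  pose h (t : R) := y t 0 i - pol (t - tn).
  pose dpol (t : R) := \sum_(j < 3) t ^+ j *
    (j.+1%:R * [:: 0; a 0 i; b 0 i / 2; c 0 i / 3]`_j.+1).
  have polE t : pol t = t * a 0 i + t ^+ 2 * (b 0 i / 2) + t ^+ 3 * (c 0 i / 3).
    by rewrite /pol !big_ord_recr big_ord0 /= mulr0 !add0r expr1.
  have pol0 : pol (tn - tn) = 0 by rewrite polE subrr; ring.
  have dshift (t : R) : is_derive t 1 (pol \o shift (- tn)) (dpol (t - tn) * 1).
    apply: is_derive1_comp; last exact: is_derive_shift.
    exact: (is_derive_powers 3 (fun j => [:: 0; a 0 i; b 0 i / 2; c 0 i / 3]`_j)).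
  have hcvg : h t @[t --> tn^'+] --> h tn.
    rewrite /h; apply: cvgB.
      by rewrite ytn; exact: cvg_row_coord.
    apply: cvg_at_right_filter; have [/derivable1_diffP dtn _] := dshift tn.
    exact: differentiable_continuous dtn.
  have hder t : tn < t < tn + T -> is_derive t 1 h (split_rhs (y t) 0 i - dpol (t - tn)).
    move=> /yder yt; rewrite -[dpol _]mulr1.
    exact: (is_deriveB (is_derive_coord i yt) (dshift t)).
  apply: (eq_bigO _ (bigO_integrate T0 hcvg hder _)).
    by move=> t /=; rewrite /h pol0 subr0 ytn [tn + t - tn]addrAC subrr add0r polE !mxE; ring.
  apply: (eq_bigO _ (HF i)) => t /=; rewrite [tn + t - tn]addrAC subrr add0r.
  by rewrite /dpol !big_ord_recr big_ord0 /=; field.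
clearbody u.
have u1 : forall i, bigO_dt 1 (fun t => u t 0 i).
  move=> i; apply: (eq_bigO _ (integ 0%N 0 0 0 _ i)) => [t|j].
    by rewrite !mxE !mul0r !mulr0 !addr0 subr0.
  have Fy : split_rhs (y (tn + t)) 0 j @[t --> 0^'+] --> f 0 j.
    have ycvg0 : y (tn + t) @[t --> 0^'+] --> yn.
      by move=> V /ycvg; exact: (nbhs_right0P tn (fun t => V (y t))).1.
    have Fc : split_rhs z @[z --> yn] --> f.
      exact: differentiable_continuous differentiable_split_rhs.
    by apply: cvg_row_coord; exact: (cvg_comp _ _ ycvg0 Fc).
  by apply: (eq_bigO _ (cvg_bigO0 Fy)) => t; rewrite !mxE !mulr0 !addr0 subr0.
have u2 : forall i, bigO_dt 2 (fun t => u t 0 i - t * f 0 i).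
  move=> i; apply: (eq_bigO _ (integ 1%N f 0 0 _ i)) => [t|j].
    by rewrite !mxE !mul0r !mulr0 !addr0.
  apply: (eq_bigO _ (split_comp1 j u1)) => t.
  by rewrite -uE !mxE !mulr0 !addr0.
have u3 : forall i, bigO_dt 3
    (fun t => u t 0 i - t * f 0 i - t ^+ 2 / 2 * (f *m J) 0 i).
  move=> i; apply: (eq_bigO _ (integ 2%N f (f *m J) 0 _ i)) => [t|j].
    by rewrite !row_entryE; field.
  apply: (eq_bigO _ (bigOD (split_comp2 j u1) (bigO_mulmx (J) j
    (fun k => _ : bigO_dt 2 (fun t => (u t - t *: f) 0 k))))) => [t|k0].
    by rewrite -uE mulmxBl -scalemxAl !row_entryE; ring.
  by apply: (eq_bigO _ (u2 k0)) => t; rewrite !mxE.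
pose Q : 'rV[R]_m := \row_j split_quad j f.
apply: (eq_bigO _ (integ 3%N f (f *m J) (2^-1 *: (f *m J *m J) + Q) _ k)).
  move=> t; rewrite /solution_taylor3 uE !row_entryE.
  by rewrite [Q _ _]mxE; field.
move=> j; apply: (eq_bigO _ (bigOD (split_comp3 j u1 u2) (bigO_mulmx J j
    (fun k => _ : bigO_dt 3 (fun t =>
       (u t - t *: f - (t ^+ 2 / 2) *: (f *m J)) 0 k))))) => [t|k0].
  rewrite -uE !mulmxBl -!scalemxAl !row_entryE.
  by rewrite [Q _ _]mxE; field.
by apply: (eq_bigO _ (u3 k0)) => t; rewrite !row_entryE.
Qed.

End Splitting.

(** * Expansion of one additive Runge-Kutta step *)

Definition rk3_conditions (R : realType) (A : 'M[R]_3) (b c : 'rV[R]_3) : Prop :=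
  [/\ \sum_i b 0 i = 1, \sum_i b 0 i * c 0 i = 1 / 2,
      \sum_i b 0 i * c 0 i ^+ 2 = 1 / 3 &
      \sum_(i < 3) \sum_(j < 3 | (j < i)%N) b 0 i * A i j * c 0 j = 1 / 6].

(* Locked, so that the entrywise rewriting rules treat it as an atom. *)
HB.lock Definition stage_increment (R : realType) (s m : nat) (yn : 'rV[R]_m)
  (Z : R -> 'M[R]_(s, m)) (i : 'I_s) (t : R) : 'rV[R]_m := row i (Z t) - yn.

Section AdditiveStep.
Variables (R : realType) (m K : nat) (U : set 'rV[R]_m) (yn : 'rV[R]_m).
Variable F : 'I_K -> 'rV[R]_m -> 'rV[R]_m.
Hypotheses (ynU : nbhs yn U) (CF : forall nu, Ck 3 U (F nu)).
Variables (A : 'M[R]_3) (b c : 'rV[R]_3).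
Hypothesis A_explicit : forall i j : 'I_3, (i <= j)%N -> A i j = 0.
Hypothesis c_def : forall i : 'I_3, \sum_j A i j = c 0 i.
Variables (w : R -> 'I_3 -> 'I_K -> R) (v : R -> 'I_K -> R).
Variables (Z : R -> 'M[R]_(3, m)) (znew : R -> 'rV[R]_m).
Hypothesis stepP : forall t, 0 <= t ->
  additive_rk_step A b (w t) (v t) F t yn (Z t) (znew t).

Local Notation f := (split_rhs F yn).
Local Notation J := (split_jacobian yn F).

Local Notation u := (stage_increment yn Z).

Lemma row_stageE i t : row i (Z t) = yn + u i t.
Proof. by rewrite stage_increment.unlock addrCA subrr addr0. Qed.

Lemma stage_incrementE i t k : 0 <= t ->
  u i t 0 k = t * \sum_(j < 3 | (j < i)%N) A i j *
    \sum_nu w t i nu * F nu (yn + u j t) 0 k.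
Proof.
move=> /stepP[/(_ i) Zi _]; rewrite [in LHS]stage_increment.unlock Zi addrAC subrr add0r.
rewrite row_entryE summxE; congr (_ * _); apply: eq_bigr => j _.
rewrite row_entryE summxE; congr (_ * _); apply: eq_bigr => nu _.
by rewrite row_entryE row_stageE.
Qed.

Lemma znewE t k : 0 <= t ->
  znew t 0 k = yn 0 k + t * \sum_nu v t nu * \sum_j b 0 j * F nu (yn + u j t) 0 k.
Proof.
move=> /stepP[_ ->]; rewrite !row_entryE summxE; congr (_ + _ * _).
under [RHS]eq_bigr do rewrite big_distrr.
rewrite exchange_big /=; apply: eq_bigr => j _.
rewrite row_entryE summxE big_distrr; apply: eq_bigr => nu _ /=.
by rewrite row_entryE row_stageE mulrCA.
Qed.

Lemma explicit_rowsum (i : 'I_3) : \sum_(j < 3 | (j < i)%N) A i j = c 0 i.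
Proof.
rewrite -c_def [RHS](bigID (fun j : 'I_3 => (j < i)%N)) /= [X in _ + X]big1 ?addr0 //.
by move=> j; rewrite -leqNgt => /A_explicit.
Qed.

Lemma explicit_c0 (i : 'I_3) : ~~ (0 < i)%N -> c 0 i = 0.
Proof.
rewrite -eqn0Ngt -explicit_rowsum => /eqP->.
by apply: big_pred0 => j; rewrite ltn0.
Qed.

Lemma part_bigO0 nu (j : 'I_3) k : (forall i, bigO_dt 1 (fun t => u j t 0 i)) ->
  bigO_dt 0 (fun t => F nu (yn + u j t) 0 k).
Proof.
move=> uj; have := Ck_comp1 ynU k (CkW (CkW (CF nu))) uj.
move=> /(bigO_weaken (leq0n 1)) H.
by apply: (eq_bigO _ (bigOD H (bigO_cst (F nu yn 0 k)))) => t; rewrite subrK.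
Qed.

Lemma stage_bigO1 (i : 'I_3) :
  (forall nu, (0 < i)%N -> bigO_dt 0 (fun t => w t i nu)) ->
  (forall j : 'I_3, (j < i)%N -> forall k, bigO_dt 1 (fun t => u j t 0 k)) ->
  forall k, bigO_dt 1 (fun t => u i t 0 k).
Proof.
move=> wi uj k; apply: near_eq_bigO.
  near=> t; apply/esym/stage_incrementE.
  by near: t; exact: nbhs_right_ge.
apply: bigO_id_mul; apply: bigO_sum => j ji; apply: bigOZ; apply: bigO_sum => nu _.
by apply: bigOMr; [apply: wi; exact: leq_ltn_trans ji|apply: part_bigO0; exact: uj].
Unshelve. all: by end_near. Qed.

Lemma stages_bigO1 : (forall (i : 'I_3) nu, (0 < i)%N -> bigO_dt 0 (fun t => w t i nu)) ->
  forall i k, bigO_dt 1 (fun t => u i t 0 k).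
Proof.
move=> wO; suff H n (i : 'I_3) : (i < n)%N -> forall k, bigO_dt 1 (fun t => u i t 0 k).
  by move=> i; exact: (H i.+1).
elim: n i => // n IH i; rewrite ltnS => ilen; apply: stage_bigO1.
  by move=> nu i0; exact: wO.
by move=> j ji; apply: IH; exact: leq_trans ji ilen.
Qed.

Hypothesis w1 : forall (i : 'I_3) nu, (0 < i)%N -> bigO_dt 1 (fun t => w t i nu - 1).

Let w0 (i : 'I_3) nu : (0 < i)%N -> bigO_dt 0 (fun t => w t i nu).
Proof.
move=> i0; have := bigO_weaken (leq0n 1) (w1 nu i0) => H.
by apply: (eq_bigO _ (bigOD H (bigO_cst 1))) => t; rewrite subrK.
Qed.

Let u1 i k : bigO_dt 1 (fun t => u i t 0 k).
Proof. exact: stages_bigO1. Qed.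

Lemma stages_bigO2 i k : bigO_dt 2 (fun t => u i t 0 k - t * c 0 i * f 0 k).
Proof.
apply: (@near_eq_bigO _ _ (fun t => t * \sum_(j < 3 | (j < i)%N) A i j *
    \sum_nu ((w t i nu - 1) * F nu (yn + u j t) 0 k
             + (F nu (yn + u j t) 0 k - F nu yn 0 k)))).
  near=> t; rewrite stage_incrementE; last by near: t; exact: nbhs_right_ge.
  rewrite -mulrA -mulrBr; congr (_ * _).
  rewrite -explicit_rowsum big_distrl -sumrB; apply: eq_bigr => j _ /=.
  rewrite -mulrBr /split_rhs summxE -sumrB; congr (_ * _).
  by apply: eq_bigr => nu _; ring.
apply: bigO_id_mul; apply: bigO_sum => j ji; apply: bigOZ; apply: bigO_sum => nu _.
apply: bigOD; last exact: (Ck_comp1 ynU k (CkW (CkW (CF nu))) (u1 j)).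
by apply: bigOMr; [apply: w1; exact: leq_ltn_trans ji|exact: part_bigO0].
Unshelve. all: by end_near. Qed.

Lemma stages_mulmx_bigO2 nu (j : 'I_3) k :
  bigO_dt 2 (fun t => F nu (yn + u j t) 0 k - F nu yn 0 k
                      - t * c 0 j * (f *m 'J (F nu) yn) 0 k).
Proof.
apply: (eq_bigO _ (bigOD (Ck_comp2 ynU k (CkW (CF nu)) (u1 j))
  (bigO_mulmx ('J (F nu) yn) k
    (fun i => _ : bigO_dt 2 (fun t => (u j t - (t * c 0 j) *: f) 0 i))))) => [t|i].
  by rewrite (mulmxBl (u j t)) -scalemxAl !row_entryE; ring.
by apply: (eq_bigO _ (stages_bigO2 j i)) => t; rewrite !row_entryE.
Qed.

Hypothesis w_quadrature : forall nu, bigO_dt 2 (fun t =>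
  \sum_(i < 3 | (0 < i)%N) b 0 i * c 0 i * w t i nu - 1 / 2).
Hypothesis rk3 : rk3_conditions A b c.

(** A single stage is only known up to O(dt^2), since its weights are only known up
    to O(dt). In the mean of the stages, the weights enter the term in [dt] through
    the quadrature sum and the term in [dt^2] through their limits. *)
Lemma stages_mean_bigO3 k : bigO_dt 3 (fun t =>
  \sum_i b 0 i * u i t 0 k - t / 2 * f 0 k - t ^+ 2 / 6 * (f *m J) 0 k).
Proof.
have [_ _ _ rk3_bac] := rk3.
pose fJ nu := (f *m 'J (F nu) yn) 0 k.
pose E (i j : 'I_3) nu t :=
  w t i nu * (F nu (yn + u j t) 0 k - F nu yn 0 k - t * c 0 j * fJ nu)
  + (w t i nu - 1) * (t * (c 0 j * fJ nu)).
have EO (i j : 'I_3) nu : (j < i)%N -> bigO_dt 2 (E i j nu).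
  move=> ji; have i0 : (0 < i)%N by exact: leq_ltn_trans ji.
  apply: bigOD; first by apply: bigOMl; [exact: w0|exact: stages_mulmx_bigO2].
  by apply: (bigOM (w1 nu i0)); apply: bigO_id_mul; exact: bigO_cst.
pose e i j t := \sum_nu E i j nu t.
have splitE i j t : \sum_nu w t i nu * F nu (yn + u j t) 0 k =
    \sum_nu w t i nu * F nu yn 0 k + t * c 0 j * (f *m J) 0 k + e i j t.
  rewrite /J mulmx_sumr summxE big_distrr /= -!big_split /=.
  by apply: eq_bigr => nu _; rewrite /E /fJ; ring.
apply: (@near_eq_bigO _ _ (fun t =>
   t * \sum_nu (\sum_(i < 3 | (0 < i)%N) b 0 i * c 0 i * w t i nu - 1 / 2) * F nu yn 0 k
   + t * \sum_(i < 3) \sum_(j < 3 | (j < i)%N) b 0 i * A i j * e i j t)).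
  near=> t; have t0 : 0 <= t by near: t; exact: nbhs_right_ge.
  have uiE (i : 'I_3) : b 0 i * u i t 0 k =
      t * (b 0 i * c 0 i * \sum_nu w t i nu * F nu yn 0 k)
      + t ^+ 2 * (\sum_(j < 3 | (j < i)%N) b 0 i * A i j * c 0 j) * (f *m J) 0 k
      + t * \sum_(j < 3 | (j < i)%N) b 0 i * A i j * e i j t.
    rewrite stage_incrementE // (eq_bigr _ (fun j _ => congr1 _ (splitE i j t))).
    rewrite -explicit_rowsum.
    move: (\sum_nu _) ((f *m J) 0 k) => x y.
    rewrite !(big_distrl, big_distrr) /= -!big_split /=; apply: eq_bigr => j _.
    by ring.
  rewrite (eq_bigr _ (fun i _ => uiE i)) !big_split /= -!big_distrr -!big_distrl /=.
  rewrite -big_distrr /= rk3_bac.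
  have -> : \sum_(i < 3) b 0 i * c 0 i * \sum_nu w t i nu * F nu yn 0 k =
      \sum_nu (\sum_(i < 3 | (0 < i)%N) b 0 i * c 0 i * w t i nu) * F nu yn 0 k.
    under [RHS]eq_bigr do rewrite big_distrl.
    rewrite [RHS]exchange_big [RHS]big_mkcond; apply: eq_bigr => i _ /=.
    case: ifPn => [_|/explicit_c0->]; last by rewrite mulr0 mul0r.
    by rewrite big_distrr; apply: eq_bigr => nu _; rewrite /= mulrA.
  under eq_bigr do rewrite mulrBl.
  by rewrite sumrB -big_distrr /= /split_rhs summxE; field.
apply: bigOD; apply: bigO_id_mul; apply: bigO_sum => i _.
  by apply: bigOMr; [exact: w_quadrature|exact: bigO_cst].
apply: bigO_sum => j ji; apply: bigOZ; apply: bigO_sum => nu _; exact: EO.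
Unshelve. all: by end_near. Qed.

Definition part_taylor2 nu k (t : R) : R :=
  F nu yn 0 k + t / 2 * (f *m 'J (F nu) yn) 0 k
  + t ^+ 2 * ((f *m J *m 'J (F nu) yn) 0 k / 6 + taylor_term k yn 2 (F nu) f / 3).

(** The linear part of the Taylor expansion of [F nu] only sees the mean of the
    stages, and the quadratic part only their leading terms. *)
Lemma part_mean_bigO3 nu k : bigO_dt 3 (fun t =>
  \sum_j b 0 j * F nu (yn + u j t) 0 k - part_taylor2 nu k t).
Proof.
have [rk3_b _ rk3_bcc _] := rk3.
pose e t : 'rV[R]_m := \sum_j b 0 j *: u j t - (t / 2) *: f - (t ^+ 2 / 6) *: (f *m J).
have eO i : bigO_dt 3 (fun t => e t 0 i).
  apply: (eq_bigO _ (stages_mean_bigO3 i)) => t; rewrite !row_entryE.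
  rewrite [(\sum_j b 0 j *: u j t) 0 i]summxE.
  by under [in RHS]eq_bigr do rewrite row_entryE.
rewrite /part_taylor2; set Q := taylor_term k yn 2 (F nu) f.
pose r (j : 'I_3) t := F nu (yn + u j t) 0 k - F nu yn 0 k
  - (u j t *m 'J (F nu) yn) 0 k - t ^+ 2 * (c 0 j ^+ 2 * Q).
have rO j : bigO_dt 3 (r j).
  rewrite /r /Q -taylor_termZ; apply: (Ck_comp3 ynU k (CF nu) (u1 j)) => i.
  by apply: (eq_bigO _ (stages_bigO2 j i)) => t; rewrite row_entryE mulrA.
clearbody Q.
apply: (@eq_bigO _ _ (fun t => \sum_j b 0 j * r j t + (e t *m 'J (F nu) yn) 0 k)).
  move=> t; rewrite /e !mulmxBl mulmx_suml !row_entryE -!scalemxAl !row_entryE.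
  rewrite [(\sum_j b 0 j *: u j t *m _) 0 k]summxE addrA addrA -big_split /=.
  have -> : \sum_j (b 0 j * r j t + (b 0 j *: u j t *m 'J (F nu) yn) 0 k) =
      \sum_j b 0 j * F nu (yn + u j t) 0 k - (\sum_j b 0 j) * F nu yn 0 k
      - t ^+ 2 * (\sum_j b 0 j * c 0 j ^+ 2) * Q.
    rewrite !(big_distrl, big_distrr) /= -!sumrB; apply: eq_bigr => j _.
    by rewrite -scalemxAl row_entryE /r; ring.
  by rewrite rk3_b rk3_bcc; field.
apply: bigOD; last exact: bigO_mulmx.
by apply: bigO_sum => j _; apply: bigOZ.
Qed.

(** An error of order [q] in the final weights costs [q + 1] in the new value, as
    they multiply increments proportional to the step size. The intermediate cases
    [q < 3] are those of the bootstrap that recovers the final weights from the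
    denominators. *)
Lemma additive_rk_taylor3 q k : (q <= 3)%N ->
  (forall nu, bigO_dt q (fun t => v t nu - 1)) ->
  bigO_dt q.+1 (fun t => znew t 0 k - solution_taylor3 yn F k t).
Proof.
move=> q3 vq; pose g nu t := \sum_j b 0 j * F nu (yn + u j t) 0 k.
have gO nu : bigO_dt 0 (g nu).
  by apply: bigO_sum => j _; apply: bigOZ; exact: part_bigO0.
apply: (@near_eq_bigO _ _ (fun t => t * \sum_nu (v t nu - 1) * g nu t
    + t * \sum_nu (g nu t - part_taylor2 nu k t))).
  near=> t; rewrite znewE; last by near: t; exact: nbhs_right_ge.
  have -> : solution_taylor3 yn F k t = yn 0 k + t * \sum_nu part_taylor2 nu k t.
    have mulJ (a : 'rV[R]_m) : (a *m J) 0 k = \sum_nu (a *m 'J (F nu) yn) 0 k.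
      by rewrite mulmx_sumr summxE.
    have fE : f 0 k = \sum_nu F nu yn 0 k by rewrite summxE.
    have collect (x1 x2 x3 x4 : 'I_K -> R) (y : R) :
        y + t * \sum_nu x1 nu + t ^+ 2 / 2 * \sum_nu x2 nu
          + t ^+ 3 * ((\sum_nu x3 nu) / 6 + (\sum_nu x4 nu) / 3) =
        y + t * \sum_nu (x1 nu + t / 2 * x2 nu + t ^+ 2 * (x3 nu / 6 + x4 nu / 3)).
      by rewrite !big_split -!big_distrr big_split -!big_distrl /=; field.
    by rewrite /solution_taylor3 !mulJ fE /split_quad collect.
  rewrite -/(g _ _); under eq_bigr do rewrite mulrBl mul1r.
  by rewrite !sumrB; ring.
apply: bigOD; apply: bigO_id_mul; apply: bigO_sum => nu _.
  by apply: bigOMr; [exact: vq|exact: gO].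
by apply: bigO_weaken q3 (part_mean_bigO3 nu k).
Unshelve. all: by end_near. Qed.

End AdditiveStep.

(** * Positivity and conservation of the Patankar step *)

Section Positivity.
Variables (R : realType) (N : nat).

Section PatankarSystem.
Variables (M : 'I_N -> 'I_N -> R) (y x : 'I_N -> R).
Hypotheses (M_ge0 : forall k nu, 0 <= M k nu) (y_gt0 : forall k, 0 < y k).
Hypothesis xE : forall k, x k = y k + \sum_nu (M k nu * x nu - M nu k * x k).

Lemma patankar_system_sum : \sum_k x k = \sum_k y k.
Proof.
rewrite (eq_bigr _ (fun k _ => xE k)) big_split /=.
under [X in _ + X]eq_bigr do rewrite sumrB.
by rewrite sumrB [X in _ - X]exchange_big /= subrr addr0.
Qed.

(** Summing the equations over the nonpositive components, the exchanges inside
    that set cancel and the others only bring mass in, so that the sum would be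
    positive. *)
Lemma patankar_system_gt0 k : 0 < x k.
Proof.
rewrite ltNge; apply/negP => xk.
pose S := [pred l | x l <= 0].
have sumS : \sum_(l in S) x l = \sum_(l in S) y l +
    \sum_(l in S) \sum_(nu | nu \notin S) (M l nu * x nu - M nu l * x l).
  rewrite (eq_bigr _ (fun l _ => xE l)) big_split /=; congr (_ + _).
  under eq_bigr do rewrite (bigID (mem S)) /=.
  rewrite big_split /= [X in X + _](_ : _ = 0) ?add0r //.
  under eq_bigr do rewrite sumrB.
  by rewrite sumrB [X in _ - X]exchange_big /= subrr.
have : \sum_(l in S) x l <= 0 by apply: sumr_le0.
apply/negP; rewrite -ltNge sumS ltr_pwDl //.
  rewrite (bigD1 k) //= ltr_pwDl //.
  by apply: sumr_ge0 => l _; exact: ltW.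
apply: sumr_ge0 => l lS; apply: sumr_ge0 => nu; rewrite inE -ltNge => xnu.
by rewrite subr_ge0 (le_trans (mulr_ge0_le0 _ _)) // mulr_ge0 // ltW.
Qed.

End PatankarSystem.

Variables (s : nat) (A : 'M[R]_s) (b : 'rV[R]_s).
Hypotheses (A_ge0 : nonneg_mx A) (b_ge0 : nonneg_mx b).
Variables (q : nat) (p d : 'I_N -> 'I_N -> 'rV[R]_N -> R).
Hypothesis pds : conservative_pds q p d.
Variables (pi : stage_denominators R s N) (sigma : final_denominators R s N).
Hypotheses (pi_adm : admissible_stage_denominators pi)
  (sigma_adm : admissible_final_denominators sigma).
Variables (yn : 'rV[R]_N) (dt : R) (Y : 'M[R]_(s, N)) (ynew : 'rV[R]_N).
Hypotheses (yn_gt0 : positive_mx yn) (dt_ge0 : 0 <= dt).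
Hypothesis step : mprk_step A b p d pi sigma dt yn Y ynew.

(* Division by the positive denominators puts one line of the scheme in the form
   of a Patankar system. *)
Let patankar_line (P : pred 'I_s) (a : 'I_s -> R) (x w : 'I_N -> R) :
  (forall j, 0 <= a j) -> (forall j, P j -> forall k, 0 < Y j k) ->
  (forall k, 0 < w k) ->
  (forall k, x k = yn 0 k + dt * \sum_(j < s | P j) a j *
     \sum_nu (p k nu (row j Y) * (x nu / w nu) - d k nu (row j Y) * (x k / w k))) ->
  (forall k, 0 < x k) /\ \sum_k x k = \sum_k yn 0 k.
Proof.
move=> a0 Y0 w0 xE; have [pd_ge0 pdE _ _ _] := pds.
pose M k nu := dt * (\sum_(j < s | P j) a j * p k nu (row j Y)) / w nu.
have M0 k nu : 0 <= M k nu.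
  apply: divr_ge0; last exact: ltW.
  apply: mulr_ge0 => //; apply: sumr_ge0 => j Pj; apply: mulr_ge0 => //.
  apply: (pd_ge0 _ _ _ _).1 => i l.
  by rewrite mxE ltW // Y0.
have xM k : x k = yn 0 k + \sum_nu (M k nu * x nu - M nu k * x k).
  rewrite [LHS]xE; congr (_ + _); rewrite big_distrr /= /M.
  rewrite (eq_bigr (fun nu => \sum_(j < s | P j) dt * (a j *
    (p k nu (row j Y) * (x nu / w nu) - d k nu (row j Y) * (x k / w k))))) => [|nu _].
    by rewrite exchange_big /=; apply: eq_bigr => j _; rewrite !big_distrr.
  rewrite !(big_distrl, big_distrr) /= -sumrB; apply: eq_bigr => j _.
  by rewrite (pdE nu k) /=; ring.
split; first by move=> k; apply: (patankar_system_gt0 M0 _ xM) => l; exact: yn_gt0.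
exact: patankar_system_sum xM.
Qed.

Let stage_line (i : 'I_s) : (forall j : 'I_s, (j < i)%N -> forall k, 0 < Y j k) ->
  (forall k, 0 < pi i yn Y 0 k) /\
  ((forall k, 0 < Y i k) /\ \sum_k Y i k = \sum_k yn 0 k).
Proof.
move=> Yj; have [pi_gt0 pi_dep _] := pi_adm.
pose Y' := \matrix_(j < s, k < N) (if (j < i)%N then Y j k else 1).
have piE : pi i yn Y = pi i yn Y'.
  by apply: pi_dep => j ji; apply/rowP => k; rewrite !mxE ji.
have pi0 k : 0 < pi i yn Y 0 k.
  rewrite piE; apply: pi_gt0 => // j l; rewrite mxE.
  by case: ifPn => // ji; exact: Yj.
split=> //.
exact: (@patankar_line (fun j : 'I_s => (j < i)%N) (A i) (Y i) _ (A_ge0 i) Yj pi0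
  (step.1 i)).
Qed.

Lemma mprk_stage_gt0 i k : 0 < Y i k.
Proof.
suff H n (l : 'I_s) : (l < n)%N -> forall k, 0 < Y l k by exact: (H i.+1).
elim: n l => // n IH l; rewrite ltnS => ln.
by have [_ []] := stage_line (fun j jl => IH j (leq_trans jl ln)).
Qed.

Lemma mprk_stage_sum i : \sum_k Y i k = \sum_k yn 0 k.
Proof. by have [_ []] := stage_line (fun j (_ : (j < i)%N) => mprk_stage_gt0 j). Qed.

Lemma mprk_pi_gt0 i k : 0 < pi i yn Y 0 k.
Proof. by have [] := stage_line (fun j (_ : (j < i)%N) => mprk_stage_gt0 j). Qed.

Lemma mprk_sigma_gt0 k : 0 < sigma dt yn Y 0 k.
Proof. by apply: sigma_adm.1 => // i j; exact: mprk_stage_gt0. Qed.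

Let final_line : (forall k, 0 < ynew 0 k) /\ \sum_k ynew 0 k = \sum_k yn 0 k.
Proof.
exact: (@patankar_line predT (b 0) (ynew 0) _ (b_ge0 0)
  (fun j _ => mprk_stage_gt0 j) mprk_sigma_gt0 step.2).
Qed.

Lemma mprk_new_gt0 k : 0 < ynew 0 k.
Proof. exact: final_line.1. Qed.

Lemma mprk_new_sum : \sum_k ynew 0 k = \sum_k yn 0 k.
Proof. exact: final_line.2. Qed.

Lemma mprk_stage_norm i k : `|Y i k| <= \sum_l yn 0 l.
Proof.
rewrite gtr0_norm ?mprk_stage_gt0 // -(mprk_stage_sum i) (bigD1 k) //= lerDl.
by apply: sumr_ge0 => l _; rewrite ltW ?mprk_stage_gt0.
Qed.

Lemma mprk_new_norm k : `|ynew 0 k| <= \sum_l yn 0 l.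
Proof.
rewrite gtr0_norm ?mprk_new_gt0 // -mprk_new_sum (bigD1 k) //= lerDl.
by apply: sumr_ge0 => l _; rewrite ltW ?mprk_new_gt0.
Qed.

End Positivity.

(** * The limit of the stage weights *)

(** Subtracting the equations satisfied by the weights 1, 1 from those satisfied by
    [o], [1 / o] and dividing by [o - 1] shows that a solution [o <> 1] would have
    [c2 = o * c1] and [b2 = b1]. Then [b1 * c1 ^+ 2 * (1 + o ^+ 2) = 1 / 3], whereas
    [a21 <= c2] gives [1 / 3 <= 2 * b1 * c1 ^+ 2 * o], so that [(o - 1) ^+ 2 <= 0].
    The nonnegativity of the coefficients is what excludes this second branch. *)
Lemma limit_weight_eq1 (R : realType) (b1 b2 c1 c2 a20 a21 o : R) :
  0 <= b1 -> 0 <= c1 -> 0 <= a20 -> c2 = a20 + a21 -> 0 < o ->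
  b1 * c1 + b2 * c2 = 1 / 2 -> b1 * c1 ^+ 2 + b2 * c2 ^+ 2 = 1 / 3 ->
  b2 * a21 * c1 = 1 / 6 ->
  b1 * c1 * o + b2 * c2 * o^-1 = 1 / 2 ->
  b1 * c1 ^+ 2 * o ^+ 2 + b2 * c2 ^+ 2 * o^-1 ^+ 2 = 1 / 3 ->
  o = 1.
Proof.
move=> b1_0 c1_0 a20_0 c2E o0 e1 e2 e3 e4 e5.
have [//|o1] := eqVneq o 1; exfalso.
have oN0 : o != 0 by rewrite gt_eqF.
have oB : o - 1 != 0 by rewrite subr_eq0.
have oD : o + 1 != 0 by rewrite gt_eqF // addr_gt0.
have z : b2 * c2 = b1 * c1 * o.
  apply: (mulIf oB); apply/eqP; rewrite -subr_eq0; apply/eqP.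
  have -> : b2 * c2 * (o - 1) - b1 * c1 * o * (o - 1) =
    o * (b1 * c1 + b2 * c2 - (b1 * c1 * o + b2 * c2 * o^-1)) by field.
  by rewrite e1 e4 subrr mulr0.
have cc : c2 * (b2 * c2) = c1 * (b1 * c1) * o ^+ 2.
  apply: (mulIf oB); apply: (mulIf oD); apply/eqP; rewrite -subr_eq0; apply/eqP.
  have -> : c2 * (b2 * c2) * (o - 1) * (o + 1) -
      c1 * (b1 * c1) * o ^+ 2 * (o - 1) * (o + 1) =
    o ^+ 2 * (b1 * c1 ^+ 2 + b2 * c2 ^+ 2 -
    (b1 * c1 ^+ 2 * o ^+ 2 + b2 * c2 ^+ 2 * o^-1 ^+ 2)) by field.
  by rewrite e2 e5 subrr mulr0.
have x0 : b1 * c1 != 0.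
  by apply/eqP => x0; move: e1; rewrite z x0 mul0r addr0; lra.
have c21 : c2 = c1 * o.
  apply: (mulIf x0); apply: (mulIf oN0); rewrite z in cc.
  have -> : c2 * (b1 * c1) * o = c2 * (b1 * c1 * o) by ring.
  by rewrite cc; ring.
have c1N0 : c1 != 0 by apply: contraNneq x0 => ->; rewrite mulr0.
have b12 : b2 = b1.
  by apply: (mulIf c1N0); apply: (mulIf oN0); rewrite -mulrA -c21 z.
have : b1 * c1 * a21 <= b1 * c1 * c2.
  by apply: ler_wpM2l; [rewrite mulr_ge0|lra].
have := e2; rewrite b12 in e3 *; rewrite c21 => h2 h3.
have : 0 < b1 * c1 ^+ 2.
  have b1N0 : b1 != 0 by apply: contraNneq x0 => ->; rewrite mul0r.
  by rewrite lt_def !mulf_neq0 ?expf_neq0 ?mulr_ge0 ?exprn_ge0.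
move=> h4; have : 0 < b1 * c1 ^+ 2 * (o - 1) ^+ 2.
  by rewrite mulr_gt0 // lt_def expf_neq0 // sqr_ge0.
nra.
Qed.

(** * Scalar test equations *)

Section ScalarTests.
Variable R : realType.

(** An explicitly solved scalar equation. The whole sequence of derivatives of the
    rate is given, so that smoothness of the systems built on it follows by
    induction; nonnegativity and the Lipschitz bound are required where a
    production-destruction system requires them, on the half line. *)
Definition scalar_test (a : R) (G : nat -> R -> R) (x : R -> R) : Prop :=
  [/\ forall n (z : R), is_derive z 1 (G n) (G n.+1 z),
      forall z, 0 <= z -> 0 <= G 0%N z,
      exists L, forall z z', 0 <= z -> 0 <= z' ->
        `|G 0%N z - G 0%N z'| <= L * `|z - z'|,
      x 0 = a &
      forall t : R, 0 <= t -> is_derive t 1 x (G 0%N (x t))].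

Variables (a10 a20 a21 b0 b1 b2 : R).

Definition scalar_stage1 (g : R -> R) (a w1 t : R) : R := a + t * (w1 * (a10 * g a)).

Definition scalar_stage2 (g : R -> R) (a w1 w2 t : R) : R :=
  a + t * (w2 * (a20 * g a + a21 * g (scalar_stage1 g a w1 t))).

Definition scalar_new (g : R -> R) (a w1 w2 v t : R) : R :=
  a + t * (v * (b0 * g a + b1 * g (scalar_stage1 g a w1 t)
                + b2 * g (scalar_stage2 g a w1 w2 t))).

Lemma bigO_expR (c : R) : bigO_dt 4
  (fun t => expR (c * t) - (1 + c * t + (c * t) ^+ 2 / 2 + (c * t) ^+ 3 / 6)).
Proof.
have der (t : R) : is_derive t 1 (fun t => expR (c * t)) (c * expR (c * t)).
  have ct : is_derive t 1 (fun t => c * t) c.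
    by apply: is_derive_eq; rewrite /GRing.scale /= mulr1.
  have := is_derive1_comp (is_derive_expR (c * t)) ct.
  by rewrite mulrC.
have integ q (p0 p1 p2 p3 : R) : bigO_dt q
      (fun t => c * expR (c * t) - (p0 + t * p1 + t ^+ 2 * p2)) ->
    bigO_dt q.+1 (fun t => expR (c * t) -
      (1 + t * p0 + t ^+ 2 * (p1 / 2) + t ^+ 3 * (p2 / 3))).
  move=> Hq; pose s := [:: 1; p0; p1 / 2; p2 / 3].
  have hd (t : R) : is_derive t 1
      (fun t => expR (c * t) - \sum_(j < 4) t ^+ j * s`_j)
      (c * expR (c * t) - \sum_(j < 3) t ^+ j * (j.+1%:R * s`_j.+1)).
    exact: (is_deriveB (der t) (is_derive_powers 3 (fun j => s`_j) t)).
  have polE (t : R) : \sum_(j < 4) t ^+ j * s`_j =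
      1 + t * p0 + t ^+ 2 * (p1 / 2) + t ^+ 3 * (p2 / 3).
    by rewrite !big_ord_recr big_ord0 /=; ring.
  apply: (eq_bigO _ (bigO_integrate (t0 := 0) (T := 1) ltr01 _ (fun t _ => hd t) _)).
  - by move=> t /=; rewrite !add0r !polE mulr0 expR0; ring.
  - apply: cvg_at_right_filter; have [/derivable1_diffP dt _] := hd 0.
    by exact: differentiable_continuous dt.
  - by apply: (eq_bigO _ Hq) => t; rewrite add0r !big_ord_recr big_ord0 /=; field.
have e0 : bigO_dt 0 (fun t => expR (c * t)).
  apply: (@cvg_bigO0 R (fun t => expR (c * t)) (expR (c * 0))).
  apply: cvg_at_right_filter; have [/derivable1_diffP dt _] := der 0.
  exact: differentiable_continuous dt.
have e1 : bigO_dt 1 (fun t => expR (c * t) - 1).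
  apply: (eq_bigO _ (integ 0%N 0 0 0 0 _)) => [t|]; first by ring.
  by apply: (eq_bigO _ (bigOZ c e0)) => t; ring.
have e2 : bigO_dt 2 (fun t => expR (c * t) - (1 + c * t)).
  apply: (eq_bigO _ (integ 1%N c 0 0 0 _)) => [t|]; first by ring.
  by apply: (eq_bigO _ (bigOZ c e1)) => t; ring.
have e3 : bigO_dt 3 (fun t => expR (c * t) - (1 + c * t + (c * t) ^+ 2 / 2)).
  apply: (eq_bigO _ (integ 2%N c (c ^+ 2) 0 0 _)) => [t|]; first by field.
  by apply: (eq_bigO _ (bigOZ c e2)) => t; ring.
apply: (eq_bigO _ (integ 3%N c (c ^+ 2) (c ^+ 3 / 2) 0 _)) => [t|]; first by field.
by apply: (eq_bigO _ (bigOZ c e3)) => t; field.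
Qed.

(** The increment may have any sign, so its exponential is controlled by the
    expansions of [expR t] and [expR (- t)] at the right of 0. *)
Lemma bigO_expRN_comp (e : R -> R) : bigO_dt 1 e ->
  bigO_dt 3 (fun t => expR (- e t) - (1 - e t + e t ^+ 2 / 2)).
Proof.
have H (c : R) : bigO_dt 3 (fun t => expR (c * t) - (1 + c * t + (c * t) ^+ 2 / 2)).
  have H3 : bigO_dt 3 (fun t => c ^+ 3 / 6 * t ^+ 3).
    by apply: bigOZ; exact: bigOXn.
  apply: (eq_bigO _ (bigOD (bigO_weaken (isT : (3 <= 4)%N) (bigO_expR c)) H3)).
  by move=> t; field.
move=> /[dup] e1 /bigO_dtP[D eD].
have [C [d /= d0 HC]] := (bigO_dtP _ _).1 (H 1).
have [C' [d' /= d'0 HC']] := (bigO_dtP _ _).1 (H (-1)).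
apply: (@bigO_bound _ _ ((`|C| + `|C'|) * `|D| ^+ 3)); near=> t.
have t0 : 0 <= t by near: t; exact: nbhs_right_ge.
have ed : `|e t| < d by near: t; exact: bigO1_lt.
have ed' : `|e t| < d' by near: t; exact: bigO1_lt.
have eDt : `|e t| <= D * t ^+ 1 by near: t.
apply: le_trans (_ : (`|C| + `|C'|) * `|e t| ^+ 3 <= _); last first.
  rewrite -mulrA ler_wpM2l ?addr_ge0 // -exprMn lerXn2r ?nnegrE ?mulr_ge0 //.
  by rewrite (le_trans eDt) // expr1 ler_wpM2r // ler_norm.
have [e0|e0|->] := ltgtP (e t) 0; last first.
- by rewrite oppr0 expR0 [0 ^+ 2]expr0n /= mul0r !addr0 subrr normr0 mulr_ge0 ?addr_ge0.
- have := HC' (e t); rewrite /= sub0r normrN => /(_ ed' e0) h.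
  rewrite !mulN1r sqrrN in h; apply: (le_trans h); rewrite (gtr0_norm e0).
  by rewrite ler_wpM2r ?exprn_ge0 ?(ltW e0) // (le_trans (ler_norm _)) // lerDr.
- have ne0 : 0 < - e t by rewrite oppr_gt0.
  have := HC (- e t); rewrite /= sub0r opprK => /(_ ed ne0) h.
  rewrite !mul1r sqrrN in h; apply: (le_trans h); rewrite (ltr0_norm e0).
  by rewrite ler_wpM2r ?exprn_ge0 ?(ltW ne0) // (le_trans (ler_norm _)) // lerDl.
Unshelve. all: by end_near. Qed.

Lemma bigO_ln1D : bigO_dt 4 (fun t : R => ln (1 + t) - (t - t ^+ 2 / 2 + t ^+ 3 / 3)).
Proof.
have der (t : R) : 0 <= t -> is_derive t 1 (fun t => ln (1 + t)) (1 + t)^-1.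
  move=> t0; have t1 : 0 < 1 + t by rewrite ltr_pwDl.
  have shiftt : is_derive t 1 (fun t : R => 1 + t) 1.
    rewrite -[X in is_derive _ _ _ X]add0r.
    exact: (is_deriveD (is_derive_cst (1 : R) t 1) (is_derive_id t 1)).
  by have := is_derive1_comp (is_derive1_ln t1) shiftt; rewrite mulr1.
pose s : seq R := [:: 0; 1; - 1 / 2; 1 / 3].
have hd (t : R) : 0 <= t -> is_derive t 1
    (fun t => ln (1 + t) - \sum_(j < 4) t ^+ j * s`_j)
    ((1 + t)^-1 - \sum_(j < 3) t ^+ j * (j.+1%:R * s`_j.+1)).
  by move=> t0; exact: (is_deriveB (der t t0) (is_derive_powers 3 (fun j => s`_j) t)).
have hder (t : R) : 0 < t < 0 + 1 -> is_derive t 1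
    (fun t => ln (1 + t) - \sum_(j < 4) t ^+ j * s`_j)
    ((1 + t)^-1 - \sum_(j < 3) t ^+ j * (j.+1%:R * s`_j.+1)).
  by move=> /andP[t0 _]; apply: hd; exact: ltW.
apply: (eq_bigO _ (bigO_integrate ltr01 _ hder _)).
- by move=> t; rewrite /= !add0r !addr0 ln1 !big_ord_recr !big_ord0 /=; field.
- apply: cvg_at_right_filter; have [/derivable1_diffP dt _] := hd 0 (lexx _).
  exact: differentiable_continuous dt.
- apply: (@near_eq_bigO _ _ (fun t => - t ^+ 3 * (1 + t)^-1)).
    near=> t; have t0 : 0 <= t by near: t; exact: nbhs_right_ge.
    have t1 : 1 + t != 0 by rewrite gt_eqF // ltr_pwDl.
    by rewrite add0r !big_ord_recr big_ord0 /=; field.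
  apply: bigOMr; first by apply: bigON; exact: bigOXn.
  apply: (@bigO_inv _ 1); first exact: oner_neq0.
  by apply: (eq_bigO _ (@bigO_id R)) => t; rewrite addrAC subrr add0r.
Unshelve. all: by end_near. Qed.

Definition scalar_order (a : R) (w1 w2 v : R -> R) : Prop :=
  forall G x, scalar_test a G x ->
    bigO_dt 4 (fun t => scalar_new (G 0%N) a (w1 t) (w2 t) (v t) t - x t).

Lemma scalar_test_cst (a : R) :
  scalar_test a (fun n => cst (if n is 0%N then 1 else 0)) (fun t => a + t).
Proof.
split=> [n z|z _|| |t _].
- exact: is_derive_cst.
- exact: ler01.
- by exists 0 => z z' _ _; rewrite subrr normr0 mul0r.
- exact: addr0.
- rewrite /cst -[X in is_derive _ _ _ X]add0r.
  exact: (is_deriveD (is_derive_cst a t 1) (is_derive_id t 1)).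
Qed.

Lemma scalar_test_linear (a r : R) : 0 < a -> 0 <= r ->
  scalar_test a (fun n z => match n with 0%N => r * z | 1%N => r | _ => 0 end)
    (fun t => a * expR (r * t)).
Proof.
have lin (x y : R) : is_derive y 1 (fun z => x * z) x.
  by have := is_deriveZ x (is_derive_id y (1 : R)); rewrite /GRing.scale /= mulr1.
move=> a0 r0; split=> [n z|z z0|| |t _].
- by case: n => [|[|n]]; [exact: lin|exact: is_derive_cst|exact: is_derive_cst].
- exact: mulr_ge0.
- by exists r => z z' _ _; rewrite -mulrBr normrM ger0_norm.
- by rewrite mulr0 expR0 mulr1.
- have de := is_derive1_comp (is_derive_expR (r * t)) (lin r t).
  have := is_deriveZ a de; rewrite /GRing.scale /=.
  by congr (is_derive _ _ _ _); rewrite mulrC mulrCA; ring.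
Qed.

Lemma scalar_test_expR (a : R) :
  scalar_test a (fun n z => (-1) ^+ n * expR (a - z)) (fun t => a + ln (1 + t)).
Proof.
split=> [n z|z _|| |t t0].
- have da : is_derive z 1 (fun z => a - z) (-1).
    rewrite -[X in is_derive _ _ _ X]add0r.
    exact: (is_deriveB (is_derive_cst a z 1) (is_derive_id z 1)).
  have := is_deriveZ ((-1) ^+ n) (@is_derive1_comp R expR (fun z => a - z) z _ _
    (is_derive_expR (a - z)) da).
  by rewrite /GRing.scale /= mulrN1 exprS !mulN1r mulNr mulrN.
- by rewrite mul1r expR_ge0.
- exists (expR a) => z z' z0 z'0; rewrite !mul1r.
  wlog zz' : z z' z0 z'0 / z <= z'.
    move=> H; have [/H|/ltW/H] := leP z z'; first exact.
    by rewrite distrC [`|z - _|]distrC; apply.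
  have le_exp : expR (a - z') <= expR (a - z) by rewrite ler_expR lerB.
  rewrite ger0_norm ?subr_ge0 // ler0_norm ?subr_le0 // opprB.
  have -> : expR (a - z') = expR (a - z) * expR (z - z').
    by rewrite -expRD; congr expR; ring.
  apply: le_trans (_ : expR (a - z) * (z' - z) <= _).
    rewrite -[X in X - _]mulr1 -mulrBr ler_wpM2l ?expR_ge0 //.
    by have := expR_ge1Dx (z - z'); lra.
  by rewrite ler_wpM2r ?subr_ge0 // ler_expR gerBl.
- by rewrite addr0 ln1 addr0.
- have t1 : 0 < 1 + t by rewrite ltr_pwDl.
  have shiftt : is_derive t 1 (fun t : R => 1 + t) 1.
    rewrite -[X in is_derive _ _ _ X]add0r.
    exact: (is_deriveD (is_derive_cst (1 : R) t 1) (is_derive_id t 1)).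
  have := is_deriveD (is_derive_cst a t 1) (is_derive1_comp (is_derive1_ln t1) shiftt).
  rewrite mulr1 add0r mul1r (_ : a - _ = - ln (1 + t)); last by ring.
  by rewrite expRN lnK.
Qed.

(** The scalar tests separate the elementary differentials. The constant rate
    isolates the final weight; the two linear rates have no second derivative and
    their slopes 1 and 2 separate the terms of degree 2 and 3; the exponential
    rate then gives the term with the second derivative. *)
Lemma scalar_order_conditions (a : R) (w1 w2 v : R -> R) : 0 < a ->
  scalar_order a w1 w2 v ->
  let c1 := a10 in let c2 := a20 + a21 in
  [/\ bigO_dt 3 (fun t => v t * (b0 + b1 + b2) - 1),
      bigO_dt 2 (fun t => v t * (b1 * c1 * w1 t + b2 * c2 * w2 t) - 1 / 2),
      bigO_dt 1 (fun t => v t * (b2 * a21 * c1 * (w1 t * w2 t)) - 1 / 6) &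
      bigO_dt 0 v -> bigO_dt 0 w1 -> bigO_dt 0 w2 ->
      bigO_dt 1 (fun t =>
        v t * (b1 * c1 ^+ 2 * w1 t ^+ 2 + b2 * c2 ^+ 2 * w2 t ^+ 2) - 1 / 3)].
Proof.
move=> a0 Ho c1 c2.
pose B t := v t * (b0 + b1 + b2) - 1.
pose P t := v t * (b1 * c1 * w1 t + b2 * c2 * w2 t) - 1 / 2.
pose Q t := v t * (b2 * a21 * c1 * (w1 t * w2 t)) - 1 / 6.
have B3 : bigO_dt 3 B.
  apply: (@bigO_Xn_cancel R 1); apply: (eq_bigO _ (Ho _ _ (scalar_test_cst a))).
  by move=> t; rewrite /scalar_new /B /cst; ring.
have lin (r : R) : 0 <= r -> bigO_dt 4 (fun t =>
    r ^+ 2 * (t ^+ 2 * P t) + r ^+ 3 * (t ^+ 3 * Q t)).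
  move=> r0; have tB : bigO_dt 4 (fun t => r * (t * B t)).
    by apply: bigOZ; exact: bigO_id_mul.
  have := bigOB (bigOD (bigOZ a^-1 (Ho _ _ (scalar_test_linear a0 r0)))
                       (bigO_expR r)) tB.
  apply: eq_bigO => t; rewrite /scalar_new /scalar_stage2 /scalar_stage1 /P /Q /B.
  by rewrite /c1 /c2; field; rewrite gt_eqF.
(* These are [t^2 P + t^3 Q] and [4 t^2 P + 8 t^3 Q]. *)
have PQ1 := lin 1 ler01; have PQ2 := lin 2 (ler0n _ 2).
have P2 : bigO_dt 2 P.
  apply: (@bigO_Xn_cancel R 2).
  apply: (eq_bigO _ (bigOZ (1 / 4) (bigOB (bigOZ 8 PQ1) PQ2))) => t.
  by field.
have Q1 : bigO_dt 1 Q.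
  apply: (@bigO_Xn_cancel R 3).
  apply: (eq_bigO _ (bigOZ (1 / 4) (bigOB PQ2 (bigOZ 4 PQ1)))) => t.
  by field.
split=> // v0 w10 w20.
pose d1 t := t * (w1 t * a10).
have d1O : bigO_dt 1 d1 by apply: bigO_id_mul; apply: bigOMr => //; exact: bigO_cst.
pose r1 t := expR (- d1 t) - (1 - d1 t + d1 t ^+ 2 / 2).
have r1O : bigO_dt 3 r1 by exact: bigO_expRN_comp.
pose m1 t := - d1 t + d1 t ^+ 2 / 2 + r1 t.
have m1O : bigO_dt 1 m1.
  apply: bigOD; last exact: bigO_weaken r1O.
  apply: bigOD; first exact: bigON.
  apply: bigOMr; last exact: bigO_cst.
  by apply: bigO_weaken (bigOM d1O d1O).
pose d2 t := t * (w2 t * (c2 + a21 * m1 t)).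
have m0 : bigO_dt 0 (fun t => c2 + a21 * m1 t).
  by apply: bigOD; [exact: bigO_cst|apply: bigOZ; exact: bigO_weaken m1O].
have d2O : bigO_dt 1 d2 by apply: bigO_id_mul; apply: bigOMr.
pose r2 t := expR (- d2 t) - (1 - d2 t + d2 t ^+ 2 / 2).
have r2O : bigO_dt 3 r2 by exact: bigO_expRN_comp.
have Hexp := Ho _ _ (scalar_test_expR a).
apply: (@bigO_Xn_cancel R 3).
(* What is O(t^3) in the increment divided by [t]. *)
pose rest t := v t * (b1 * r1 t + b2 * r2 t
   - b2 * (t * w2 t * (a21 * (d1 t ^+ 2 / 2 + r1 t)))
   + b2 * (t * w2 t) ^+ 2 * (2 * c2 * (a21 * m1 t) + (a21 * m1 t) ^+ 2) / 2).
have restO : bigO_dt 3 rest.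
  apply: bigOMl => //; have tw2 : bigO_dt 1 (fun t => t * w2 t) by exact: bigO_id_mul.
  have am : bigO_dt 1 (fun t => a21 * m1 t) by exact: bigOZ.
  apply: bigOD; first apply: bigOB.
  - by apply: bigOD; exact: bigOZ.
  - apply: bigOZ; apply: (bigOM tw2); apply: bigOZ; apply: bigOD.
      by apply: bigOMr; [exact: (bigOM d1O d1O)|exact: bigO_cst].
    exact: bigO_weaken r1O.
  - apply: bigOMr; last exact: bigO_cst.
    apply: (@bigOM R 2 1); first by apply: bigOZ; exact: (bigOM tw2 tw2).
    apply: bigOD; first by apply: bigOZ.
    exact: bigO_weaken (bigOM am am).
have := bigOZ 2 (bigOD (bigOB (bigOB (bigOD Hexp bigO_ln1D) (bigO_id_mul B3))
  (bigO_id_mul restO)) (bigOB (bigOM (bigOXn R 2) P2) (bigOM (bigOXn R 3) Q1))).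
apply: eq_bigO => t.
have stage1 : scalar_stage1 (fun z => (-1) ^+ 0 * expR (a - z)) a (w1 t) t = a + d1 t.
  by rewrite /scalar_stage1 subrr expR0 /d1; ring.
have E1 : expR (- d1 t) = 1 - d1 t + d1 t ^+ 2 / 2 + r1 t by rewrite /r1; ring.
have stage2 : scalar_stage2 (fun z => (-1) ^+ 0 * expR (a - z)) a (w1 t) (w2 t) t
    = a + d2 t.
  rewrite /scalar_stage2 stage1 subrr expR0 (_ : a - (a + d1 t) = - d1 t); last ring.
  by rewrite E1 /d2 /m1 /c2; ring.
have E2 : expR (- d2 t) = 1 - d2 t + d2 t ^+ 2 / 2 + r2 t by rewrite /r2; ring.
rewrite /scalar_new stage1 stage2 subrr expR0.
rewrite (_ : a - (a + d1 t) = - d1 t); last by ring.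
rewrite (_ : a - (a + d2 t) = - d2 t); last by ring.
rewrite E1 E2 /B /P /Q /rest /d2 /m1 /d1 /c1.
move: (r1 t) (r2 t) (ln (1 + t)) => x1 x2 x3.
by field.
Qed.

End ScalarTests.

(** * From scalar equations to test systems *)

Section ThreeStages.

Definition stage0 : 'I_3 := ord0.
Definition stage1 : 'I_3 := Ordinal (isT : (1 < 3)%N).
Definition stage2 : 'I_3 := Ordinal (isT : (2 < 3)%N).

Lemma stage_ind (P : 'I_3 -> Prop) : P stage0 -> P stage1 -> P stage2 -> forall i, P i.
Proof.
move=> P0 P1 P2 [[|[|[|//]]] i3].
- by rewrite (_ : Ordinal i3 = stage0) //; exact: val_inj.
- by rewrite (_ : Ordinal i3 = stage1) //; exact: val_inj.
- by rewrite (_ : Ordinal i3 = stage2) //; exact: val_inj.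
Qed.

Lemma big_stages (V : zmodType) (P : pred 'I_3) (E : 'I_3 -> V) :
  \sum_(i < 3 | P i) E i = (if P stage0 then E stage0 else 0)
    + (if P stage1 then E stage1 else 0) + (if P stage2 then E stage2 else 0).
Proof.
have o0 : widen_ord (leqnSn 2) (widen_ord (leqnSn 1) ord_max) = stage0 by exact: val_inj.
have o1 : widen_ord (leqnSn 2) ord_max = stage1 by exact: val_inj.
have o2 : ord_max = stage2 :> 'I_3 by exact: val_inj.
by rewrite big_mkcond !big_ord_recr big_ord0 /= o0 o1 o2 add0r.
Qed.

End ThreeStages.

Section LineTests.
Variable R : realType.

Lemma Ck_row_profile (m n q : nat) (U : set 'rV[R]_m) (G : nat -> R -> R) (k : 'I_m) :
  (forall r (z : R), is_derive z 1 (G r) (G r.+1 z)) ->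
  forall r (e : 'rV[R]_n), Ck q U (fun y => G r (y 0 k) *: e).
Proof.
move=> dG.
have dGr r (z : R) : differentiable (G r) z.
  by have [? _] := dG r z; apply/derivable1_diffP.
have dc (y : 'rV[R]_m) : differentiable (fun y : 'rV[R]_m => y 0 k) y.
  exact: differentiable_coord.
have dGc r y : differentiable (G r \o (fun y : 'rV[R]_m => y 0 k)) y.
  exact: differentiable_comp.
elim: q => [|q IH] r e /=.
  move=> y _; apply: differentiable_continuous; exact: differentiableZl (dGc r y).
split=> [y _|i]; first exact: differentiableZl (dGc r y).
have -> : (fun y => 'D_(delta_mx 0 i) (fun y : 'rV[R]_m => G r (y 0 k) *: e) y) =
    (fun y => G r.+1 (y 0 k) *: ((delta_mx 0 i : 'rV[R]_m) 0 k *: e)).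
  apply/funext => y; rewrite deriveE; last exact: differentiableZl (dGc r y).
  rewrite (diffZl e (dGc r y)) (diff_comp (dc y) (dGr r _)) /= diff1E //.
  have [_ Gy] := dG r (y 0 k); rewrite derive1E Gy scalerA; congr (_ *: _).
  rewrite /GRing.scale /= mulrC; congr (_ * _); rewrite -deriveE //.
  have := derive_mx (@derivable_id R 'rV[R]_m y (delta_mx 0 i)).
  by rewrite derive_id => /rowP/(_ k); rewrite [in RHS]mxE => ->.
exact: IH.
Qed.

Variables (m K : nat) (k : 'I_m) (l : 'I_K) (e : 'rV[R]_m).
Hypothesis ek : e 0 k = 1.

(** Both the one-species systems that test the underlying Runge-Kutta scheme and the
    two-species reactions that test the weights have this form. *)
Definition line_part (g : R -> R) (nu : 'I_K) (y : 'rV[R]_m) : 'rV[R]_m :=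
  g (y 0 k) *: (if nu == l then e else 0).

Definition line_point (yn : 'rV[R]_m) (x : R) : 'rV[R]_m := yn + (x - yn 0 k) *: e.

Lemma line_pointE yn x : line_point yn x 0 k = x.
Proof. by rewrite /line_point !row_entryE ek mulr1 addrCA subrr addr0. Qed.

Lemma sum_line_part (g : R -> R) y (w : 'I_K -> R) :
  \sum_nu w nu *: line_part g nu y = (w l * g (y 0 k)) *: e.
Proof.
rewrite (bigD1 l) //= big1 => [|nu nul].
  by rewrite /line_part eqxx addr0 scalerA.
by rewrite /line_part (negbTE nul) !scaler0.
Qed.

Lemma additive_rk_step_line (A : 'M[R]_3) (b : 'rV[R]_3) (w : 'I_3 -> 'I_K -> R)
    (v : 'I_K -> R) (g : R -> R) (dt : R) (yn : 'rV[R]_m) :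
  let a := yn 0 k in
  let a10 := A stage1 stage0 in
  let a20 := A stage2 stage0 in let a21 := A stage2 stage1 in
  let z1 := scalar_stage1 a10 g a (w stage1 l) dt in
  let z2 := scalar_stage2 a10 a20 a21 g a (w stage1 l) (w stage2 l) dt in
  additive_rk_step A b w v (line_part g) dt yn
    (\matrix_(i, j) line_point yn (if i == stage0 then a
       else if i == stage1 then z1 else z2) 0 j)
    (line_point yn (scalar_new a10 a20 a21 (b 0 stage0) (b 0 stage1) (b 0 stage2)
       g a (w stage1 l) (w stage2 l) (v l) dt)).
Proof.
move=> a a10 a20 a21 z1 z2.
set Z := \matrix_(i, j) _.
have Z0 : row stage0 Z = line_point yn a by apply/rowP => j; rewrite !mxE.
have Z1 : row stage1 Z = line_point yn z1 by apply/rowP => j; rewrite !mxE.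
have Z2 : row stage2 Z = line_point yn z2 by apply/rowP => j; rewrite !mxE.
split=> [i|].
  under eq_bigr do rewrite sum_line_part.
  move: i; apply: stage_ind; rewrite big_stages /= ?addr0 ?add0r.
  - by rewrite Z0 /line_point subrr scale0r scaler0 !addr0.
  - rewrite Z0 Z1 line_pointE /line_point /z1 /scalar_stage1 addrAC subrr add0r !scalerA.
    by congr (_ + _ *: _); rewrite /a10; ring.
  - rewrite Z0 Z1 Z2 !line_pointE /line_point /z2 /scalar_stage2 addrAC subrr add0r.
    rewrite !scalerA -scalerDl !scalerA.
    by congr (_ + _ *: _); rewrite /a20 /a21 /z1; ring.
under eq_bigr do rewrite sum_line_part.
rewrite big_stages Z0 Z1 Z2 !line_pointE /line_point /scalar_new addrAC subrr add0r.
by rewrite !scalerA -!scalerDl !scalerA; congr (_ + _ *: _); rewrite /z1 /z2; ring.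
Qed.

Lemma is_derive_line (yn : 'rV[R]_m) (x : R -> R) (t dx : R) :
  is_derive t 1 x dx -> is_derive t 1 (fun t => line_point yn (x t)) (dx *: e).
Proof.
move=> xt; have der i j : is_derive t 1
    (fun t => line_point yn (x t) i j) (dx * e i j).
  rewrite (_ : (fun t => _) = cst (yn i j - yn 0 k * e i j) + e i j *: x); last first.
    by apply/funext => s; rewrite /line_point !mxE addrfctE scalrfctE /GRing.scale /=; ring.
  have := is_deriveD (is_derive_cst (yn i j - yn 0 k * e i j) t 1)
                     (is_deriveZ (e i j) xt).
  by rewrite add0r /GRing.scale /= [e i j * dx]mulrC.
have dl : derivable (fun t => line_point yn (x t)) t 1.
  by apply/derivable_mxP => i j; have [] := der i j.
apply: DeriveDef => //; rewrite derive_mx //; apply/matrixP => i j.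
by have [_ dij] := der i j; rewrite !mxE dij.
Qed.

Lemma ivp_solution_line (a : R) G x (yn : 'rV[R]_m) (F : 'rV[R]_m -> 'rV[R]_m) :
  yn 0 k = a -> scalar_test a G x -> (forall y, F y = G 0%N (y 0 k) *: e) ->
  ivp_solution F 0 1 yn (fun t => line_point yn (x t)).
Proof.
move=> ynk [_ _ _ x0 dx] FE; split.
- by rewrite x0 /line_point ynk subrr scale0r addr0.
- have [/derivable1_diffP d0 _] := is_derive_line yn (dx 0 (lexx _)).
  have : line_point yn (x t) @[t --> 0] --> line_point yn (x 0).
    exact: differentiable_continuous d0.
  rewrite [line_point yn (x 0)]/line_point x0 ynk subrr scale0r addr0.
  exact: cvg_at_right_filter.
- move=> t /andP[t0 _]; rewrite FE line_pointE.
  by apply: is_derive_line; apply: dx; exact: ltW.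
Qed.

Lemma ler_row_coord (y : 'rV[R]_m) i : `|y 0 i| <= `|y|.
Proof.
rewrite [leRHS]/Num.Def.normr /= mx_normrE.
exact: (le_bigmax _ (fun ij => `|y ij.1 ij.2|) (0, i)).
Qed.

End LineTests.

Section TestTransfer.
Variables (R : realType) (A : 'M[R]_3) (b : 'rV[R]_3).

Local Notation a10 := (A stage1 stage0).
Local Notation a20 := (A stage2 stage0).
Local Notation a21 := (A stage2 stage1).
Local Notation order := (scalar_order a10 a20 a21 (b 0 stage0) (b 0 stage1) (b 0 stage2)).

Lemma rk_order_scalar (a : R) :
  rk_order 3 A b -> order a (fun=> 1) (fun=> 1) (fun=> 1).
Proof.
move=> rk G x Gx; pose e : 'rV[R]_1 := const_mx 1.
have ek : e 0 ord0 = 1 by rewrite mxE.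
pose F (y : 'rV[R]_1) := G 0%N (y 0 ord0) *: e.
have FE : (fun=> F) = line_part ord0 (ord0 : 'I_1) e (G 0%N).
  by apply/funext => nu; apply/funext => y; rewrite /line_part (ord1 nu) eqxx.
have [dG _ _ _ _] := Gx.
have ynE : (const_mx a : 'rV[R]_1) 0 ord0 = a by rewrite mxE.
have CF : Ck 4 setT F by exact: Ck_row_profile.
have ivp := ivp_solution_line ek ynE Gx (fun y => erefl (F y)).
have steps dt (_ : 0 <= dt) := additive_rk_step_line (ord0 : 'I_1) ek A b
  (fun _ _ => 1) (fun=> 1) (G 0%N) dt (const_mx a).
rewrite -FE in steps; have := rk _ F 0 1 _ _ _ _ CF ltr01 ivp steps ord0.
by apply: eq_bigO => t; rewrite add0r !line_pointE // ynE.
Qed.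

(** The test system is a single reaction turning the species [l] into the species
    [k], at a rate which depends on [y_k] only. Its solutions move along a line, and
    only the weights of the species [l] act, so that each species can be tested
    separately. *)
Lemma mprk_order_scalar (N : nat) (pi : stage_denominators R 3 N)
    (sigma : final_denominators R 3 N) (yn : 'rV[R]_N)
    (Y : R -> 'M[R]_(3, N)) (ynew : R -> 'rV[R]_N) (k l : 'I_N) :
  k != l -> mprk_order 3 A b pi sigma yn Y ynew ->
  order (yn 0 k) (fun t => stage_weight pi yn Y t stage1 l)
    (fun t => stage_weight pi yn Y t stage2 l)
    (fun t => final_weight sigma yn Y ynew t l).
Proof.
move=> kl ord G x Gx; have [dG G0 [L GL] _ _] := Gx.
pose e : 'rV[R]_N := delta_mx 0 k - delta_mx 0 l.
have ek : e 0 k = 1 by rewrite !mxE !eqxx (negbTE kl) subr0.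
pose p (i nu : 'I_N) (y : 'rV[R]_N) :=
  if (i == k) && (nu == l) then G 0%N (y 0 k) else 0.
pose d i nu y := p nu i y.
have partE : pds_part p d = line_part k l e (G 0%N).
  apply/funext => nu; apply/funext => y; apply/rowP => i.
  rewrite /line_part /d /p; have [->|nul] := eqVneq nu l; rewrite !mxE /=.
    have [->|il] := eqVneq i l.
      rewrite (bigD1 k) //= big1 => [|j /negbTE->]; last by [].
      by rewrite !eqxx eq_sym (negbTE kl) addr0 sub0r mulrN1.
    rewrite eqxx andbT subr0.
    by case: eqVneq => _; rewrite ?mulr1 ?mulr0.
  rewrite mulr0 (negbTE nul) andbF; case: eqVneq => // ->.
  by rewrite big1 ?oppr0 // => j _; rewrite (negbTE nul) andbF.
have rhsE y : pds_rhs p d y = G 0%N (y 0 k) *: e.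
  have := sum_line_part k l e (G 0%N) y (fun=> 1); rewrite mul1r => <-.
  by rewrite /pds_rhs partE; apply: eq_bigr => nu _; rewrite scale1r.
have pds : conservative_pds 4 p d.
  split=> //.
  - move=> i nu y y0; rewrite /d /p; split; case: ifP => // _; exact: G0.
  - move=> i y; rewrite /d /p; case: ifP => // /andP[/eqP->].
    by rewrite (negbTE kl).
  - move=> nu; rewrite partE; pose D : 'rV[R]_N := if nu == l then e else 0.
    apply: (@klipschitzW _ _ _ (`|L| * `|D|)).
      apply: (@globally_properfilter _ _ (0, 0)).
      by split => i j; rewrite mxE.
    move=> [y y'] /= [y0 y'0]; rewrite /line_part -scalerBl normrZ mulrAC.
    rewrite ler_wpM2r // (le_trans (GL _ _ (y0 0 k) (y'0 0 k))) //.
    apply: le_trans (_ : `|L| * `|y 0 k - y' 0 k| <= _).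
      by rewrite ler_wpM2r // ler_norm.
    by rewrite ler_wpM2l //; have := ler_row_coord (y - y') k; rewrite !mxE.
  - by move=> nu; rewrite partE; exact: Ck_row_profile.
have ivp := ivp_solution_line ek erefl Gx rhsE.
have steps dt (_ : 0 <= dt) := additive_rk_step_line l ek A b
  (stage_weight pi yn Y dt) (final_weight sigma yn Y ynew dt) (G 0%N) dt yn.
rewrite -partE in steps; have := ord p d 0 1 _ _ _ pds ltr01 ivp steps k.
by apply: eq_bigO => t; rewrite add0r !line_pointE.
Qed.

End TestTransfer.

(** * Characterization of order 3 *)

Section RungeKuttaConditions.
Variables (R : realType) (A : 'M[R]_3) (b c : 'rV[R]_3).
Hypothesis A_explicit : forall i j : 'I_3, (i <= j)%N -> A i j = 0.
Hypothesis c_def : forall i : 'I_3, \sum_j A i j = c 0 i.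

Lemma explicit3_abscissae :
  [/\ c 0 stage0 = 0, c 0 stage1 = A stage1 stage0 &
      c 0 stage2 = A stage2 stage0 + A stage2 stage1].
Proof.
rewrite -!(explicit_rowsum A_explicit c_def) !big_stages /=.
by rewrite !addr0.
Qed.

Lemma rk_order3_conditions : rk_order 3 A b -> rk3_conditions A b c.
Proof.
move=> rk; have [c0 c1 c2] := explicit3_abscissae.
have [e1 e2 e3] := scalar_order_conditions ltr01 (rk_order_scalar (a := 1) rk).
move=> /(_ (bigO_cst 1) (bigO_cst 1) (bigO_cst 1)) e4.
have {}e1 := subr0_eq (bigO1_cst_eq0 (bigO_weaken (isT : (1 <= 3)%N) e1)).
have {}e2 := subr0_eq (bigO1_cst_eq0 (bigO_weaken (isT : (1 <= 2)%N) e2)).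
have {}e3 := subr0_eq (bigO1_cst_eq0 e3).
have {}e4 := subr0_eq (bigO1_cst_eq0 e4).
split; rewrite !big_stages /= ?c0 ?c1 ?c2.
- by rewrite -[RHS]e1 mul1r.
- by rewrite -[RHS]e2; ring.
- by rewrite -[RHS]e4; ring.
- by rewrite -[RHS]e3; ring.
Qed.

End RungeKuttaConditions.

Section MPRKOrder3.
Variables (R : realType) (N : nat) (A : 'M[R]_3) (b c : 'rV[R]_3).
Hypothesis A_explicit : forall i j : 'I_3, (i <= j)%N -> A i j = 0.
Hypotheses (A_ge0 : nonneg_mx A) (b_ge0 : nonneg_mx b).
Hypothesis c_def : forall i : 'I_3, \sum_j A i j = c 0 i.
Hypothesis rk3 : rk3_conditions A b c.
Variables (p d : 'I_N -> 'I_N -> 'rV[R]_N -> R).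
Hypothesis pds : conservative_pds 4 p d.
Variables (pi : stage_denominators R 3 N) (sigma : final_denominators R 3 N).
Hypotheses (pi_adm : admissible_stage_denominators pi)
  (sigma_adm : admissible_final_denominators sigma).
Variables (yn : 'rV[R]_N) (Y : R -> 'M[R]_(3, N)) (ynew : R -> 'rV[R]_N).
Hypothesis yn_gt0 : positive_mx yn.
Hypothesis scheme : forall dt, 0 <= dt ->
  mprk_step A b p d pi sigma dt yn (Y dt) (ynew dt).

Local Notation f := (pds_rhs p d).
Local Notation F := (pds_part p d).
Local Notation W := (stage_weight pi yn Y).
Local Notation V := (final_weight sigma yn Y ynew).
Local Notation den i t nu := (pi i yn (Y t) 0 nu).
Local Notation fin t nu := (sigma t yn (Y t) 0 nu).

Lemma nbhs_positive_mx : nbhs yn (@positive_mx R 1 N).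
Proof.
have H := @filter_forall _ _ (fun (j : 'I_N) (y : 'rV[R]_N) => 0 < y 0 j) _ (nbhs_filter yn)
  (fun j => @cvgr_gt _ _ _ (nbhs_filter yn) _ _ (@coord_continuous R 1 N 0 j yn) 0 (yn_gt0 0 j)).
by apply: filterS H => y y0 i j; rewrite [i]ord1.
Qed.

Lemma pds_part_Ck3 p' d' nu : conservative_pds 4 p' d' ->
  Ck 3 (@positive_mx R 1 N) (pds_part p' d' nu).
Proof. by move=> [_ _ _ _ CF]; exact: CkW. Qed.

Let ynU := nbhs_positive_mx.
Let CF nu := pds_part_Ck3 nu pds.

Let stepP t : 0 <= t -> additive_rk_step A b (W t) (V t) F t yn (Y t) (ynew t).
Proof. by move=> t0; apply: (mprk_step_additive pds); exact: scheme. Qed.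

Let near_ge0 : \forall t \near (0 : R)^'+, 0 <= t.
Proof. exact: nbhs_right_ge. Qed.

Let Y_gt0 t i k : 0 <= t -> 0 < Y t i k.
Proof. by move=> t0; exact: (mprk_stage_gt0 A_ge0 pds pi_adm yn_gt0 t0 (scheme t0)). Qed.

Let den_gt0 t i k : 0 <= t -> 0 < den i t k.
Proof. by move=> t0; exact: (mprk_pi_gt0 A_ge0 pds pi_adm yn_gt0 t0 (scheme t0)). Qed.

Let ynew_gt0 t k : 0 <= t -> 0 < ynew t 0 k.
Proof.
move=> t0; exact: (mprk_new_gt0 A_ge0 b_ge0 pds pi_adm sigma_adm yn_gt0 t0 (scheme t0)).
Qed.

Let fin_gt0 t k : 0 <= t -> 0 < fin t k.
Proof.
by move=> t0; exact: (mprk_sigma_gt0 A_ge0 pds pi_adm sigma_adm yn_gt0 t0 (scheme t0)).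
Qed.

Let Y_O0 i k : bigO_dt 0 (fun t => Y t i k).
Proof.
apply: (@bigO_bound _ _ (\sum_l yn 0 l)); apply: filterS near_ge0 => t t0.
by rewrite mulr1 (mprk_stage_norm A_ge0 pds pi_adm yn_gt0 t0 (scheme t0)).
Qed.

Let ynew_O0 k : bigO_dt 0 (fun t => ynew t 0 k).
Proof.
apply: (@bigO_bound _ _ (\sum_l yn 0 l)); apply: filterS near_ge0 => t t0.
rewrite mulr1.
exact: (mprk_new_norm A_ge0 b_ge0 pds pi_adm sigma_adm yn_gt0 t0 (scheme t0)).
Qed.

Let incrE i t k : stage_increment yn Y i t 0 k = Y t i k - yn 0 k.
Proof. by rewrite stage_increment.unlock !mxE. Qed.

Let yn_neq0 k : yn 0 k != 0.
Proof. by rewrite gt_eqF. Qed.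

(* The quadrature condition on the weights and the one on the denominators differ
   by a term of order 2, because the stages are y^n + dt c_i f + O(dt^2). *)
Let quadrature_diff nu :
  (forall (i : 'I_3) nu, (0 < i)%N -> bigO_dt 1 (fun t => W t i nu - 1)) ->
  (forall (i : 'I_3) nu, (0 < i)%N -> bigO_dt 0 (fun t => (den i t nu)^-1)) ->
  bigO_dt 2 (fun t =>
    \sum_(i < 3 | (0 < i)%N) b 0 i * c 0 i * W t i nu -
    \sum_(i < 3 | (0 < i)%N) b 0 i * c 0 i *
      ((yn 0 nu + t * c 0 i * f yn 0 nu) / den i t nu)).
Proof.
move=> w1 den0; apply: (@eq_bigO _ _ (fun t => \sum_(i < 3 | (0 < i)%N) b 0 i * c 0 i *
  ((stage_increment yn Y i t 0 nu - t * c 0 i * f yn 0 nu) * (den i t nu)^-1))).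
  move=> t; rewrite -sumrB; apply: eq_bigr => i _.
  by rewrite incrE /stage_weight; ring.
apply: bigO_sum => i i0; apply: bigOZ; apply: bigOMr; last exact: den0.
exact: (stages_bigO2 ynU CF A_explicit c_def stepP w1).
Qed.

Let taylor2 k (t : R) := yn 0 k + t * f yn 0 k + t ^+ 2 / 2 * (f yn *m 'J f yn) 0 k.

Let taylor3_diff k : bigO_dt 3 (fun t => solution_taylor3 yn F k t - taylor2 k t).
Proof.
have JE : 'J f yn = split_jacobian yn F by exact: jacobian_split_rhs ynU CF.
pose q := (f yn *m split_jacobian yn F *m split_jacobian yn F) 0 k / 6
          + split_quad yn F k (f yn) / 3.
apply: (@eq_bigO _ _ (fun t => t ^+ 3 * q)).
  by move=> t; rewrite /taylor2 JE /solution_taylor3 -/(split_rhs F) /q; ring.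
by apply: bigOMr; [exact: bigOXn|exact: bigO_cst].
Qed.

Let taylor2_O1 k : bigO_dt 1 (fun t => taylor2 k t - yn 0 k).
Proof.
apply: (@eq_bigO _ _ (fun t =>
  t * (f yn 0 k + t * ((f yn *m 'J f yn) 0 k / 2)))).
  by move=> t; rewrite /taylor2; ring.
apply: bigO_id_mul; apply: bigOD; first exact: bigO_cst.
by apply: bigOMr; [exact: bigO_weaken (@bigO_id R)|exact: bigO_cst].
Qed.

Section Sufficiency.
Hypothesis fin_cond : forall mu, bigO_dt 3 (fun t => fin t mu - taylor2 mu t).
Hypothesis quad_cond : forall nu, bigO_dt 2 (fun t =>
  \sum_(i < 3 | (0 < i)%N) b 0 i * c 0 i *
     ((yn 0 nu + t * c 0 i * f yn 0 nu) / den i t nu) - 1 / 2).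
Hypothesis den_cond : forall nu (i : 'I_3), (0 < i)%N ->
  bigO_dt 1 (fun t => den i t nu - yn 0 nu).

Let den_inv (i : 'I_3) nu : (0 < i)%N -> bigO_dt 0 (fun t => (den i t nu)^-1).
Proof. by move=> i0; apply: bigO_inv (yn_neq0 nu) _; exact: den_cond. Qed.

Let stages1 i k : bigO_dt 1 (fun t => stage_increment yn Y i t 0 k).
Proof.
apply: (stages_bigO1 ynU CF stepP) => j nu j0.
exact: (bigOMr (Y_O0 j nu) (den_inv nu j0)).
Qed.

Let w1 (i : 'I_3) nu : (0 < i)%N -> bigO_dt 1 (fun t => W t i nu - 1).
Proof.
move=> i0; apply: (@near_eq_bigO _ _ (fun t =>
   (stage_increment yn Y i t 0 nu - (den i t nu - yn 0 nu)) * (den i t nu)^-1)).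
  apply: filterS near_ge0 => t t0; rewrite incrE /stage_weight.
  by field; rewrite gt_eqF ?den_gt0.
by apply: bigOMr; [apply: bigOB; [exact: stages1|exact: den_cond]|exact: den_inv].
Qed.

Let w_quad nu : bigO_dt 2 (fun t =>
  \sum_(i < 3 | (0 < i)%N) b 0 i * c 0 i * W t i nu - 1 / 2).
Proof.
apply: (eq_bigO _ (bigOD (quadrature_diff nu w1 den_inv) (quad_cond nu))) => t.
by rewrite subrKA.
Qed.

Let fin_O1 k : bigO_dt 1 (fun t => fin t k - yn 0 k).
Proof.
apply: (eq_bigO _ (bigOD (bigO_weaken (isT : (1 <= 3)%N) (fin_cond k)) (taylor2_O1 k))).
by move=> t; rewrite subrKA.
Qed.

(* Bootstrap: final weights accurate to order [q] give a new value accurate to order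
   [q + 1], and dividing it by the denominators gives weights of that accuracy. *)
Let v_bigO q nu : (q <= 3)%N -> bigO_dt q (fun t => V t nu - 1).
Proof.
have fin_inv k : bigO_dt 0 (fun t => (fin t k)^-1).
  exact: bigO_inv (yn_neq0 k) (fin_O1 k).
elim: q nu => [|q IH] nu q3.
  by apply: bigOB; [exact: (bigOMr (ynew_O0 nu) (fin_inv nu))|exact: bigO_cst].
have new := additive_rk_taylor3 ynU CF A_explicit c_def stepP w1 w_quad rk3 nu (ltnW q3)
  (fun nu => IH nu (ltnW q3)).
apply: (@near_eq_bigO _ _ (fun t =>
  (ynew t 0 nu - solution_taylor3 yn F nu t
   + (solution_taylor3 yn F nu t - taylor2 nu t)
   - (fin t nu - taylor2 nu t)) * (fin t nu)^-1)).
  apply: filterS near_ge0 => t t0; rewrite /final_weight.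
  by field; rewrite gt_eqF ?fin_gt0.
apply: bigOMr => //; apply: bigOB; last exact: bigO_weaken q3 (fin_cond nu).
by apply: bigOD => //; exact: bigO_weaken q3 (taylor3_diff nu).
Qed.

(** The weights do not depend on the system that they are applied to, and neither do
    the conditions on them: one expansion serves all systems. *)
Lemma mprk_order3_sufficient : mprk_order 3 A b pi sigma yn Y ynew.
Proof.
move=> p' d' tn T y Z znew pds' T0 ivp steps k.
have CF' nu := pds_part_Ck3 nu pds'.
have num := additive_rk_taylor3 ynU CF' A_explicit c_def steps w1 w_quad rk3 k (leqnn 3)
  (fun nu => v_bigO nu (leqnn 3)).
have sol := ivp_solution_taylor3 ynU CF' k T0 ivp.
by apply: (eq_bigO _ (bigOB num sol)) => t; rewrite opprB subrKA.
Qed.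

End Sufficiency.

Section Necessity.
Hypothesis N_gt1 : (1 < N)%N.
Hypothesis ord3 : mprk_order 3 A b pi sigma yn Y ynew.

Let other (l : 'I_N) : exists k, k != l.
Proof.
apply/existsP; apply: contraLR N_gt1; rewrite negb_exists -leqNgt => /forallP H.
rewrite -[X in (X <= _)%N]card_ord -(card1 l); apply: subset_leq_card.
by apply/fintype.subsetP => k _; have := H k; rewrite negbK inE.
Qed.

Local Notation b1 := (b 0 stage1).
Local Notation b2 := (b 0 stage2).
Local Notation c1 := (c 0 stage1).
Local Notation c2 := (c 0 stage2).
Local Notation a21 := (A stage2 stage1).

Let rk3E : [/\ b1 * c1 + b2 * c2 = 1 / 2, b1 * c1 ^+ 2 + b2 * c2 ^+ 2 = 1 / 3 &
  b2 * a21 * c1 = 1 / 6].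
Proof.
have [_ e2 e3 e4] := rk3; have [c0 _ _] := explicit3_abscissae A_explicit c_def.
move: e2 e3 e4; rewrite !big_stages /= c0 => e2 e3 e4.
by split; [rewrite -[RHS]e2|rewrite -[RHS]e3|rewrite -[RHS]e4]; ring.
Qed.

Let v3 nu : bigO_dt 3 (fun t => V t nu - 1).
Proof.
have [k knu] := other nu; have [rk_b _ _ _] := rk3.
have [e1 _ _ _] := scalar_order_conditions (yn_gt0 0 k) (mprk_order_scalar knu ord3).
apply: (eq_bigO _ e1) => t; move: rk_b; rewrite big_stages /= => ->.
by rewrite mulr1.
Qed.

(* Up to O(dt^3) the final weight is 1, and dividing by it is harmless. *)
Let v_cancel q (g : R -> R) (r : R) nu : (q <= 3)%N ->
  bigO_dt q (fun t => V t nu * g t - r) -> bigO_dt q (fun t => g t - r).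
Proof.
move=> q3 Hg; have v1 := bigO_weaken (isT : (1 <= 3)%N) (v3 nu).
apply: (@near_eq_bigO _ _ (fun t =>
   (V t nu * g t - r - r * (V t nu - 1)) * (V t nu)^-1)).
  apply: filterS (bigO_inv_near (oner_neq0 R) v1) => t vt.
  by field.
apply: bigOMr; last exact: bigO_inv (oner_neq0 R) v1.
by apply: bigOB => //; apply: bigOZ; exact: bigO_weaken q3 (v3 nu).
Qed.

Let w_quad nu : bigO_dt 2 (fun t =>
  \sum_(i < 3 | (0 < i)%N) b 0 i * c 0 i * W t i nu - 1 / 2).
Proof.
have [k knu] := other nu; have [_ c1E c2E] := explicit3_abscissae A_explicit c_def.
have [_ e2 _ _] := scalar_order_conditions (yn_gt0 0 k) (mprk_order_scalar knu ord3).
apply: (@v_cancel 2 _ _ nu isT); apply: (eq_bigO _ e2) => t.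
by rewrite big_stages /= add0r c1E c2E.
Qed.

Let w_prod nu : bigO_dt 1 (fun t => W t stage1 nu * W t stage2 nu - 1).
Proof.
have [k knu] := other nu; have [_ c1E c2E] := explicit3_abscissae A_explicit c_def.
have [_ _ e3 _] := scalar_order_conditions (yn_gt0 0 k) (mprk_order_scalar knu ord3).
have [_ _ bac] := rk3E; rewrite -c1E bac in e3.
apply: (eq_bigO _ (bigOZ 6 (@v_cancel 1 _ _ nu isT e3))) => t.
by field.
Qed.

(* The first stage is y^n itself, so that these denominators do not see [t]. *)
Let den1 t nu : 0 <= t -> den stage1 t nu = den stage1 0 nu.
Proof.
move=> t0; have [_ dep _] := pi_adm; rewrite (dep stage1 yn (Y t) (Y 0)) // => j j1.
have row0 s : 0 <= s -> row stage0 (Y s) = yn.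
  move=> /stepP[/(_ stage0) -> _].
  by rewrite big1 ?scaler0 ?addr0 // => i; rewrite ltn0.
have -> : j = stage0 by apply/val_inj/eqP; rewrite -leqn0 -ltnS.
by rewrite !row0.
Qed.

(* The limit of the first weight, known to exist before it is known to be 1. *)
Let om nu := yn 0 nu / den stage1 0 nu.

Let om_gt0 nu : 0 < om nu.
Proof. by rewrite divr_gt0 ?den_gt0. Qed.

Let om_neq0 nu : om nu != 0.
Proof. by rewrite gt_eqF. Qed.

Let W1_lim nu : bigO_dt 1 (fun t => W t stage1 nu - om nu).
Proof.
have W1_O0 l : bigO_dt 0 (fun t => W t stage1 l).
  apply: (@near_eq_bigO _ _ (fun t => Y t stage1 l * (den stage1 0 l)^-1)).
    by apply: filterS near_ge0 => t t0; rewrite /stage_weight den1.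
  by apply: bigOMr => //; exact: bigO_cst.
have stage1_O1 : forall k, bigO_dt 1 (fun t => stage_increment yn Y stage1 t 0 k).
  apply: (stage_bigO1 ynU CF stepP) => // j j1 k.
  by move: j j1; apply: stage_ind => // _; apply: (stage_bigO1 ynU CF stepP).
apply: (@near_eq_bigO _ _ (fun t =>
   stage_increment yn Y stage1 t 0 nu * (den stage1 0 nu)^-1)).
  apply: filterS near_ge0 => t t0.
  by rewrite incrE mulrBl /stage_weight den1.
by apply: bigOMr => //; exact: bigO_cst.
Qed.

Let W1_inv nu : bigO_dt 0 (fun t => (W t stage1 nu)^-1).
Proof. exact: bigO_inv (om_neq0 nu) (W1_lim nu). Qed.

(* The product of the two weights tends to 1, so that the second one converges
   because the first one does. *)
Let W2_lim nu : bigO_dt 1 (fun t => W t stage2 nu - (om nu)^-1).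
Proof.
apply: (@near_eq_bigO _ _ (fun t => (W t stage1 nu * W t stage2 nu - 1
    - (W t stage1 nu - om nu) * (om nu)^-1) * (W t stage1 nu)^-1)).
  apply: filterS (bigO_inv_near (om_neq0 nu) (W1_lim nu)) => t wt.
  by field; rewrite om_neq0.
apply: bigOMr => //; apply: bigOB => //.
by apply: bigOMr => //; exact: bigO_cst.
Qed.

Let W_O0 (r : R) i nu : bigO_dt 1 (fun t => W t i nu - r) ->
  bigO_dt 0 (fun t => W t i nu).
Proof.
move=> /(bigO_weaken (leq0n 1)) H.
by apply: (eq_bigO _ (bigOD H (bigO_cst r))) => t; rewrite subrK.
Qed.

Let om_eq1 nu : om nu = 1.
Proof.
have [k knu] := other nu; have [_ c1E c2E] := explicit3_abscissae A_explicit c_def.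
have [rk2 rk3' rk3''] := rk3E.
have [_ _ _ e4] := scalar_order_conditions (yn_gt0 0 k) (mprk_order_scalar knu ord3).
have V0 : bigO_dt 0 (fun t => V t nu).
  apply: (eq_bigO _ (bigOD (bigO_weaken (leq0n 3) (v3 nu)) (bigO_cst 1))) => t.
  by rewrite subrK.
have {}e4 := e4 V0 (W_O0 (W1_lim nu)) (W_O0 (W2_lim nu)).
rewrite -c1E -c2E in e4; have {}e4 := @v_cancel 1 _ _ nu isT e4.
have sq (x r : R -> R) (l : R) : bigO_dt 1 (fun t => x t - l) ->
    bigO_dt 1 (fun t => x t ^+ 2 - l ^+ 2).
  move=> xl; apply: (@eq_bigO _ _ (fun t => (x t - l) * ((x t - l) + 2 * l))).
    by move=> t; ring.
  apply: bigOMr => //; apply: bigOD; last exact: bigO_cst.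
  exact: bigO_weaken xl.
apply: (@limit_weight_eq1 R b1 b2 c1 c2 (A stage2 stage0) a21) => //.
- by rewrite c1E.
- apply/eqP; rewrite -subr_eq0; apply/eqP/bigO1_cst_eq0.
  apply: (eq_bigO _ (bigOB (bigO_weaken (isT : (1 <= 2)%N) (w_quad nu))
    (bigOD (bigOZ (b1 * c1) (W1_lim nu)) (bigOZ (b2 * c2) (W2_lim nu))))) => t.
  by rewrite big_stages /=; ring.
- apply/eqP; rewrite -subr_eq0; apply/eqP/bigO1_cst_eq0.
  apply: (eq_bigO _ (bigOB e4 (bigOD
    (bigOZ (b1 * c1 ^+ 2) (sq _ id _ (W1_lim nu)))
    (bigOZ (b2 * c2 ^+ 2) (sq _ id _ (W2_lim nu)))))) => t.
  by ring.
Qed.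

Let w1 (i : 'I_3) nu : (0 < i)%N -> bigO_dt 1 (fun t => W t i nu - 1).
Proof.
move: i; apply: stage_ind => // _.
  by have := W1_lim nu; rewrite om_eq1.
by have := W2_lim nu; rewrite om_eq1 invr1.
Qed.

Lemma mprk_order3_denominators nu (i : 'I_3) : (0 < i)%N ->
  bigO_dt 1 (fun t => den i t nu - yn 0 nu).
Proof.
move=> i0; have stages1 := stages_bigO1 ynU CF stepP
  (fun (j : 'I_3) nu (j0 : (0 < j)%N) => W_O0 (w1 nu j0)).
apply: (@near_eq_bigO _ _ (fun t => (stage_increment yn Y i t 0 nu
    - yn 0 nu * (W t i nu - 1)) * (W t i nu)^-1)).
  apply: filterS near_ge0 => t t0; rewrite incrE /stage_weight.
  by field; rewrite !gt_eqF ?den_gt0 ?Y_gt0.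
apply: bigOMr; last exact: bigO_inv (oner_neq0 R) (w1 nu i0).
by apply: bigOB => //; apply: bigOZ; exact: w1.
Qed.

Lemma mprk_order3_quadrature nu : bigO_dt 2 (fun t =>
  \sum_(i < 3 | (0 < i)%N) b 0 i * c 0 i *
     ((yn 0 nu + t * c 0 i * f yn 0 nu) / den i t nu) - 1 / 2).
Proof.
have den_inv (i : 'I_3) l : (0 < i)%N -> bigO_dt 0 (fun t => (den i t l)^-1).
  by move=> i0; apply: bigO_inv (yn_neq0 l) _; exact: mprk_order3_denominators.
apply: (eq_bigO _ (bigOB (w_quad nu) (quadrature_diff nu w1 den_inv))) => t.
by ring.
Qed.

Lemma mprk_order3_final_denominators mu :
  bigO_dt 3 (fun t => fin t mu - taylor2 mu t).
Proof.
have new := additive_rk_taylor3 ynU CF A_explicit c_def stepP w1 w_quad rk3 mu (leqnn 3) v3.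
have v1 := bigO_weaken (isT : (1 <= 3)%N) (v3 mu).
apply: (@near_eq_bigO _ _ (fun t =>
  (ynew t 0 mu - solution_taylor3 yn F mu t
   + (solution_taylor3 yn F mu t - taylor2 mu t)
   - (V t mu - 1) * taylor2 mu t) * (V t mu)^-1)).
  apply: filterS near_ge0 => t t0; rewrite /final_weight.
  by field; rewrite !gt_eqF ?fin_gt0 ?ynew_gt0.
apply: bigOMr; last exact: bigO_inv (oner_neq0 R) v1.
apply: bigOB; first by apply: bigOD => //; exact: bigO_weaken new.
apply: bigOMr => //; have := bigO_weaken (leq0n 1) (taylor2_O1 mu) => H.
by apply: (eq_bigO _ (bigOD H (bigO_cst (yn 0 mu)))) => t; rewrite subrK.
Qed.

End Necessity.

End MPRKOrder3.

Theorem theorem4p13 (R : realType) (N : nat) (N_gt1 : (1 < N)%N)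
    (A : 'M[R]_3) (b c : 'rV[R]_3)
    (A_explicit : forall i j : 'I_3, (i <= j)%N -> A i j = 0)
    (A_ge0 : nonneg_mx A) (b_ge0 : nonneg_mx b)
    (c_def : forall i : 'I_3, \sum_j A i j = c 0 i)
    (rk_order3 : rk_order 3 A b)
    (p d : 'I_N -> 'I_N -> 'rV[R]_N -> R)
    (pds : conservative_pds 4 p d)
    (pi : stage_denominators R 3 N) (sigma : final_denominators R 3 N)
    (pi_adm : admissible_stage_denominators pi)
    (sigma_adm : admissible_final_denominators sigma)
    (yn : 'rV[R]_N) (yn_gt0 : positive_mx yn)
    (Y : R -> 'M[R]_(3, N)) (ynew : R -> 'rV[R]_N)
    (scheme : forall dt, 0 <= dt ->
       mprk_step A b p d pi sigma dt yn (Y dt) (ynew dt)) :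
  let f := pds_rhs p d in
  mprk_order 3 A b pi sigma yn Y ynew <->
  [/\ forall mu : 'I_N, bigO_dt 3 (fun dt =>
        sigma dt yn (Y dt) 0 mu -
        (yn 0 mu + dt * f yn 0 mu
         + dt ^+ 2 / 2 * (f yn *m 'J f yn) 0 mu)),
      forall nu : 'I_N, bigO_dt 2 (fun dt =>
        \sum_(i < 3 | (0 < i)%N) b 0 i * c 0 i *
          ((yn 0 nu + dt * c 0 i * f yn 0 nu) / pi i yn (Y dt) 0 nu)
        - 1 / 2) &
      forall (nu : 'I_N) (i : 'I_3), (0 < i)%N -> bigO_dt 1 (fun dt =>
        pi i yn (Y dt) 0 nu - yn 0 nu)].
Proof.
move=> f; have rk3 := rk_order3_conditions A_explicit c_def rk_order3.
split=> [ord3|[fin_cond quad_cond den_cond]].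
  split.
  - exact: (mprk_order3_final_denominators A_explicit A_ge0 b_ge0 c_def rk3 pds
      pi_adm sigma_adm yn_gt0 scheme N_gt1 ord3).
  - exact: (mprk_order3_quadrature A_explicit A_ge0 b_ge0 c_def rk3 pds
      pi_adm yn_gt0 scheme N_gt1 ord3).
  - exact: (mprk_order3_denominators A_explicit A_ge0 b_ge0 c_def rk3 pds
      pi_adm yn_gt0 scheme N_gt1 ord3).
exact: (mprk_order3_sufficient A_explicit A_ge0 b_ge0 c_def rk3 pds
  pi_adm sigma_adm yn_gt0 scheme fin_cond quad_cond den_cond).
Qed.
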